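(* Let $(A,\rho,[\cdot,\cdot])$ be an almost Lie algebroid on a smooth manifold $M$, let $(\Pi,\xi)$ be a Jacobi structure on it, and let $\lambda\in\Gamma(A^\star)$. If $\xi-\sharp_{\Pi,\xi}(\lambda)\in\ker\rho$, then the skew algebroid $(A^\star,\rho_{\Pi,\xi},[\cdot,\cdot]^\lambda_{\Pi,\xi})$ is an almost Lie algebroid, i.e. $$\rho_{\Pi,\xi}\left([\alpha,\beta]^\lambda_{\Pi,\xi}\right)=\left[\rho_{\Pi,\xi}(\alpha),\rho_{\Pi,\xi}(\beta)\right]\qquad\text{for all }\alpha,\beta\in\Gamma(A^\star).$$ The converse is also true if $\Pi\neq 0$: that is, if $\Pi\neq 0$ and $(A^\star,\rho_{\Pi,\xi},[\cdot,\cdot]^\lambda_{\Pi,\xi})$ is an almost Lie algebroid, then $\xi-\sharp_{\Pi,\xi}(\lambda)\in\ker\rho$.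
   Context: A skew algebroid on $M$ is a triple $(A,\rho,[\cdot,\cdot])$ where $A\to M$ is a vector bundle, $\rho:A\to TM$ is a vector bundle morphism (the anchor), and $[\cdot,\cdot]$ is a skew-symmetric $\mathbb{R}$-bilinear bracket on $\Gamma(A)$ with $[a,\varphi b]=\varphi[a,b]+(\rho(a)\cdot\varphi)b$ for $\varphi\in C^\infty(M)$. It is an almost Lie algebroid if moreover $\rho([a,b])=[\rho(a),\rho(b)]$ for all $a,b\in\Gamma(A)$. An $A$-vector field is a section of $A$, an $A$-bivector field is a section of $\wedge^2A$. $A^\star$ is the dual bundle of $A$. Lie derivative: $\mathcal{L}^\rho_a\varphi=\rho(a)\cdot\varphi$, $(\mathcal{L}^\rho_a\eta)(a_1,\dots,a_k)=\rho(a)\cdot\eta(a_1,\dots,a_k)-\sum_i\eta(a_1,\dots,[a,a_i],\dots,a_k)$ for $\eta\in\Gamma(\wedge^kA^\star)$, and $\langle\mathcal{L}^\rho_aP,\eta\rangle=\rho(a)\cdot\langle P,\eta\rangle-\langle P,\mathcal{L}^\rho_a\eta\rangle$ for multivector fields $P$. For a function $\varphi$, $d_\rho\varphi(a)=\rho(a)\cdot\varphi$. The Schouten–Nijenhuis bracket on $\Gamma(\wedge^\bullet A)$ is the unique $\mathbb{R}$-bilinear bracket with $[\varphi,\psi]=0$ for functions, $[a,P]=\mathcal{L}^\rho_aP$ for $a\in\Gamma(A)$, $[P,Q]=(-1)^{kl}[Q,P]$ and $[P,Q\wedge R]=[P,Q]\wedge R+(-1)^{(k+1)l}Q\wedge[P,R]$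 for $P\in\Gamma(\wedge^kA)$, $Q\in\Gamma(\wedge^lA)$, $R\in\Gamma(\wedge^\bullet A)$. Exterior products are normalised so that $(\xi\wedge\Pi)(\alpha,\beta,\gamma)=\alpha(\xi)\Pi(\beta,\gamma)+\beta(\xi)\Pi(\gamma,\alpha)+\gamma(\xi)\Pi(\alpha,\beta)$. A pair $(\Pi,\xi)$ of an $A$-bivector field and an $A$-vector field is a Jacobi structure if $[\Pi,\Pi]=2\xi\wedge\Pi$ and $[\xi,\Pi]=\mathcal{L}^\rho_\xi\Pi=0$. $\sharp_\Pi:A^\star\to A$ is defined by $\beta(\sharp_\Pi(\alpha))=\Pi(\alpha,\beta)$; the Koszul bracket is $[\alpha,\beta]_\Pi=\mathcal{L}^\rho_{\sharp_\Pi(\alpha)}\beta-\mathcal{L}^\rho_{\sharp_\Pi(\beta)}\alpha-d_\rho(\Pi(\alpha,\beta))$; $\sharp_{\Pi,\xi}(\alpha)=\sharp_\Pi(\alpha)+\alpha(\xi)\xi$; $\rho_{\Pi,\xi}=\rho\circ\sharp_{\Pi,\xi}$; and $$[\alpha,\beta]^\lambda_{\Pi,\xi}=[\alpha,\beta]_\Pi+\alpha(\xi)(\mathcal{L}^\rho_\xi\beta-\beta)-\beta(\xi)(\mathcal{L}^\rho_\xi\alpha-\alpha)-\Pi(\alpha,\beta)\lambda.$$ The triple $(A^\star,\rho_{\Pi,\xi},[\cdot,\cdot]^\lambda_{\Pi,\xi})$ is a skew algebroid.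
   Formalization: In the converse, ''Π≠0'' is read pointwise: ξ−♯_{Π,ξ}(λ) is shown to lie in ker ρ at every point x where Π_x≠0 (hence everywhere if Π vanishes on no nonempty open set); with Π merely not identically zero the converse is false. *)

(* Defs.v *)
From HB Require Import structures.
From mathcomp Require Import all_boot all_order all_algebra.
From mathcomp Require Import all_classical all_reals all_analysis.

Set Implicit Arguments.
Unset Strict Implicit.
Unset Printing Implicit Defensive.

Import Order.TTheory GRing.Theory Num.Theory.
Import numFieldNormedType.Exports.

Local Open Scope classical_set_scope.
Local Open Scope ring_scope.

(** * Smooth manifolds *)

(* [U] is meant to be open *)
Fixpoint Ck_on (R : realType) (n k : nat) (U : set 'rV[R]_n)
    (f : 'rV[R]_n -> R) : Prop :=
  if k is k'.+1 then
    (forall y, U y -> differentiable f y) /\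
    (forall v : 'rV[R]_n, Ck_on k' U (fun y => 'D_v f y))
  else forall y, U y -> {for y, continuous f}.

Definition Coo_on (R : realType) (n : nat) (U : set 'rV[R]_n)
    (f : 'rV[R]_n -> R) : Prop := forall k, Ck_on k U f.

(* [chart_inv] is only meaningful on the image of [chart_dom] *)
Record chart (R : realType) (n : nat) (M : topologicalType) := Chart {
  chart_dom : set M;
  chart_map :> M -> 'rV[R]_n;
  chart_inv : 'rV[R]_n -> M;
  chart_dom_open : open chart_dom;
  chart_img_open : open (chart_map @` chart_dom);
  chart_mapK : forall x, chart_dom x -> chart_inv (chart_map x) = x;
  chart_map_cont : forall x, chart_dom x -> {for x, continuous chart_map};
  chart_inv_cont : forall y, (chart_map @` chart_dom) y ->
    {for y, continuous chart_inv} }.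

Record manifold (R : realType) := Manifold {
  carrier :> topologicalType;
  manifold_dim : nat;
  atlas : set (chart R manifold_dim carrier);
  manifold_hausdorff : hausdorff_space carrier;
  manifold_second_countable : @second_countable carrier;
  atlas_cover : forall x, exists2 c, atlas c & chart_dom c x;
  atlas_smooth : forall c d, atlas c -> atlas d -> forall j : 'I_manifold_dim,
    Coo_on (c @` (chart_dom c `&` chart_dom d))
           (fun y => d (chart_inv c y) 0 j) }.

(* [W] is meant to be open *)
Definition smooth_on (R : realType) (M : manifold R) (W : set M)
    (f : M -> R) : Prop :=
  forall c, atlas c -> Coo_on (c @` (chart_dom c `&` W)) (f \o chart_inv c).

Definition smooth (R : realType) (M : manifold R) (f : M -> R) : Prop :=
  smooth_on [set: M] f.

(* Tangent vectors at [x] are derivations of the smooth functions at [x]; the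
   values on non-smooth functions are junk, so two tangent vectors are the same
   when they agree on smooth functions. *)
Record tangent_vector (R : realType) (M : manifold R) (x : M)
    (v : (M -> R) -> R) : Prop := TangentVector {
  tangent_linear : forall (c : R) (f g : M -> R), smooth f -> smooth g ->
    v (fun y => c * f y + g y) = c * v f + v g;
  tangent_leibniz : forall f g : M -> R, smooth f -> smooth g ->
    v (fun y => f y * g y) = f x * v g + g x * v f }.

(** * Vector bundles *)

(* A local trivialisation is given as a local frame; values of a frame outside
   its domain are junk. *)
Record vbundle (R : realType) (M : manifold R) := VBundle {
  fiber :> M -> vectType R;
  rank : nat;
  frame_index : Type;
  frame_dom : frame_index -> set M;
  frame : frame_index -> forall x, rank.-tuple (fiber x);
  frame_dom_open : forall i, open (frame_dom i);
  frame_cover : forall x, exists i, frame_dom i x;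
  frame_basis : forall i x, frame_dom i x -> basis_of fullv (frame i x);
  frame_smooth : forall i j, exists2 g : 'I_rank -> 'I_rank -> M -> R,
    (forall k l, smooth_on (frame_dom i `&` frame_dom j) (g k l)) &
    (forall x, frame_dom i x -> frame_dom j x -> forall k,
       tnth (frame i x) k = \sum_l g k l x *: tnth (frame j x) l) }.

Definition section_of (R : realType) (M : manifold R) (E : vbundle M) : Type :=
  forall x : M, E x.

Definition smooth_section (R : realType) (M : manifold R) (E : vbundle M)
    (s : section_of E) : Prop :=
  forall i, exists2 c : 'I_(rank E) -> M -> R,
    (forall k, smooth_on (frame_dom i) (c k)) &
    (forall x, frame_dom i x -> s x = \sum_k c k x *: tnth (frame i x) k).

Section DualBundle.
Variables (R : realType) (M : manifold R) (E : vbundle M).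

Definition dual_fiber (x : M) : vectType R := 'Hom(E x, R^o).

Definition dual_frame (i : frame_index E) (x : M) :
    (rank E).-tuple (dual_fiber x) :=
  [tuple linfun (coord (frame i x) k : E x -> R^o) | k < rank E].

Lemma dual_frameE i x (a : dual_fiber x) : frame_dom i x ->
  a = \sum_k (a (tnth (frame i x) k) : R) *: tnth (dual_frame i x) k.
Proof.
move=> xi; apply/lfunP => v.
rewrite {1}(coord_basis (frame_basis xi) (memvf v)) linear_sum sum_lfunE.
apply: eq_bigr => k _; rewrite linearZ /= scale_lfunE tnth_mktuple lfunE /=.
by rewrite (tnth_nth 0); exact: mulrC.
Qed.

Lemma dual_frame_basis i x : frame_dom i x ->
  basis_of fullv (dual_frame i x).
Proof.
move=> xi; have /andP[_ fE] := frame_basis xi.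
rewrite basisEfree; apply/and3P; split.
- have nE (l : 'I_(rank E)) (v : E x) : (dual_frame i x)`_l v = coord (frame i x) l v.
    by rewrite -tnth_nth tnth_mktuple lfunE.
  apply/freeP => k k0 j.
  have := congr1 (fun a : dual_fiber x => a (tnth (frame i x) j) : R) k0.
  rewrite zero_lfunE sum_lfunE (bigD1 j) // big1 => [|l lj].
    rewrite /= addr0 scale_lfunE nE (tnth_nth 0) coord_free // eqxx => <-.
    by rewrite [RHS]mulr1.
  rewrite scale_lfunE nE (tnth_nth 0) coord_free //.
  by rewrite eq_sym (negbTE lj) scaler0.
- exact: subvf.
- have := size_basis (frame_basis xi); rewrite size_tuple !dimvf => e.
  have -> : vector.dim (dual_fiber x) = (vector.dim (E x) * 1)%N by [].
  by rewrite e muln1.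
Qed.

Lemma dual_frame_smooth i j :
  exists2 g : 'I_(rank E) -> 'I_(rank E) -> M -> R,
    (forall k l, smooth_on (frame_dom i `&` frame_dom j) (g k l)) &
    (forall x, frame_dom i x -> frame_dom j x -> forall k,
       tnth (dual_frame i x) k = \sum_l g k l x *: tnth (dual_frame j x) l).
Proof.
have [g gs gE] := frame_smooth j i.
exists (fun k l => g l k) => [k l|x xi xj k]; first by rewrite setIC.
have /andP[_ fE] := frame_basis xi.
rewrite [LHS](dual_frameE _ xj); apply: eq_bigr => l _; congr (_ *: _).
rewrite tnth_mktuple lfunE /= gE // linear_sum (bigD1 k) //= big1 => [|m mk].
  by rewrite addr0 linearZ /= (tnth_nth 0) coord_free // eqxx mulr1.
by rewrite linearZ /= (tnth_nth 0) coord_free // (negbTE mk) mulr0.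
Qed.

Definition dual : vbundle M := VBundle (@frame_dom_open R M E)
  (@frame_cover R M E) dual_frame_basis dual_frame_smooth.

End DualBundle.

(** * Skew algebroids *)

Section Algebroid.
Variables (R : realType) (M : manifold R) (E : vbundle M).

Definition anchor : Type := forall x : M, E x -> (M -> R) -> R.

(* only its values on smooth sections are meaningful *)
Definition bracket : Type := section_of E -> section_of E -> section_of E.

Variables (rho : anchor) (br : bracket).

(* [rho(a) . f] *)
Definition act (a : section_of E) (f : M -> R) : M -> R :=
  fun x => rho (a x) f.

Record bundle_map_to_TM : Prop := BundleMapToTM {
  anchor_tangent : forall x (v : E x), tangent_vector x (rho v);
  anchor_linear : forall x (c : R) (v w : E x) (f : M -> R), smooth f ->
    rho (c *: v + w) f = c * rho v f + rho w f;
  anchor_smooth : forall (a : section_of E) (f : M -> R),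
    smooth_section a -> smooth f -> smooth (act a f) }.

Record skew_algebroid : Prop := SkewAlgebroid {
  skew_anchor : bundle_map_to_TM;
  skew_closed : forall a b, smooth_section a -> smooth_section b ->
    smooth_section (br a b);
  skew_symmetric : forall a b, smooth_section a -> smooth_section b ->
    forall x, br a b x = - br b a x;
  skew_linearl : forall (c : R) a a' b,
    smooth_section a -> smooth_section a' -> smooth_section b ->
    forall x, br (fun y => c *: a y + a' y) b x = c *: br a b x + br a' b x;
  skew_linearr : forall (c : R) a b b',
    smooth_section a -> smooth_section b -> smooth_section b' ->
    forall x, br a (fun y => c *: b y + b' y) x = c *: br a b x + br a b' x;
  skew_leibniz : forall (f : M -> R) a b,
    smooth f -> smooth_section a -> smooth_section b ->
    forall x, br a (fun y => f y *: b y) x = f x *: br a b x + act a f x *: b x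
}.

Definition anchor_compatible : Prop :=
  forall a b, smooth_section a -> smooth_section b ->
  forall f : M -> R, smooth f -> forall x,
    act (br a b) f x = act a (act b f) x - act b (act a f) x.

Definition almost_lie_algebroid : Prop := skew_algebroid /\ anchor_compatible.

Definition in_ker_anchor x (v : E x) : Prop :=
  forall f : M -> R, smooth f -> rho v f = 0.

End Algebroid.

(** * Multivector fields *)

(* A multivector at [x] is a function of finite lists of covectors at [x]; the
   homogeneous ones of degree k vanish on lists of length different from k and
   are alternating k-linear forms on lists of length k. *)
Definition multivector (R : realType) (M : manifold R) (A : vbundle M) : Type :=
  forall x : M, seq (dual A x) -> R.

Section Multivectors.
Variables (R : realType) (M : manifold R) (A : vbundle M).
Implicit Types (P Q : multivector A) (k l : nat).

Record mvfield k P : Prop := MVField {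
  mv_degree : forall x s, size s <> k -> P x s = 0;
  mv_linear : forall x s t (c : R) (u v : dual A x),
    P x (s ++ c *: u + v :: t) = c * P x (s ++ u :: t) + P x (s ++ v :: t);
  mv_alternating : forall x s t w (u : dual A x),
    P x (s ++ u :: t ++ u :: w) = 0;
  mv_smooth : forall i (J : seq 'I_(rank (dual A))),
    smooth_on (frame_dom i)
      (fun x => P x [seq tnth (frame (v:=dual A) i x) j | j <- J]) }.

Definition mv_of_fun (f : M -> R) : multivector A :=
  fun x s => if s is [::] then f x else 0.

Definition mv_of_section (a : section_of A) : multivector A :=
  fun x s => if s is [:: u] then u (a x) else 0.

Definition mv_comb (c : R) P Q : multivector A := fun x s => c * P x s + Q x s.

(* All the ways [(n, s1, s2)] of splitting [s] into complementary sublists, with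
   the number [n] of inversions of the corresponding shuffle. *)
Fixpoint unshuffles (T : Type) (s : seq T) : seq (nat * seq T * seq T) :=
  if s is u :: s' then
    [seq (p.1.1, u :: p.1.2, p.2) | p <- unshuffles s'] ++
    [seq ((p.1.1 + size p.1.2)%N, p.1.2, u :: p.2) | p <- unshuffles s']
  else [:: (0%N, [::], [::])].

Definition wedge P Q : multivector A := fun x s =>
  \sum_(p <- unshuffles s) (-1) ^+ p.1.1 * P x p.1.2 * Q x p.2.

Lemma wedge_normalisation (a : section_of A) P x (u v w : dual A x) :
  mvfield 2 P ->
  wedge (mv_of_section a) P [:: u; v; w] =
  u (a x) * P x [:: v; w] + v (a x) * P x [:: w; u] + w (a x) * P x [:: u; v].
Proof.
move=> P2; have alt t : P x [:: t; t] = 0 := mv_alternating P2 [::] [::] [::] t.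
have addl t t' r : P x [:: t + t'; r] = P x [:: t; r] + P x [:: t'; r].
  by have := mv_linear P2 [::] [:: r] 1 t t'; rewrite scale1r mul1r.
have addr t t' r : P x [:: r; t + t'] = P x [:: r; t] + P x [:: r; t'].
  by have := mv_linear P2 [:: r] [::] 1 t t'; rewrite scale1r mul1r.
have := alt (u + w); rewrite addl !addr !alt add0r addr0 => /eqP.
rewrite addr_eq0 => /eqP uw.
rewrite /wedge /= !big_cons big_nil /= uw.
rewrite !(mulr0, mul0r, add0r, addr0, expr0, mul1r, expr1, expr2, mulrN1, mulrNN).
by rewrite mulN1r mulrNN addrA.
Qed.

Variables (rho : anchor A) (br : bracket A).

(* [L_a eta] at [x] is the unique covector with this property, because the
   right-hand side is tensorial in [b]. *)
Definition lie_form (a : section_of A) (eta : section_of (dual A)) :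
    section_of (dual A) := fun x =>
  xget 0 [set theta : dual A x | forall b, smooth_section b ->
    theta (b x) = act rho a (fun y => eta y (b y)) x - eta x (br a b x)].

(* [Q = L_a P]: the duality defining [L_a P] is written out for the decomposable
   forms [eta], the exterior products of [al 0], up to [al k.-1]. *)
Definition is_lie_mv k (a : section_of A) P Q : Prop :=
  forall al : nat -> section_of (dual A), (forall j, smooth_section (al j)) ->
  forall x, Q x (mkseq (fun j => al j x) k) =
    act rho a (fun y => P y (mkseq (fun j => al j y) k)) x -
    \sum_(i < k) P x (mkseq (fun j =>
       if j == i then lie_form a (al j) x else al j x) k).

(* The defining properties of the Schouten-Nijenhuis bracket, on homogeneous
   multivector fields; they determine it there. In degree (0, 0), the degree
   [(0 + 0).-1 = 0] is harmless since the bracket vanishes. *)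
Record schouten_bracket (SN : multivector A -> multivector A -> multivector A)
    : Prop := SchoutenBracket {
  sn_degree : forall k l P Q, mvfield k P -> mvfield l Q ->
    mvfield (k + l).-1 (SN P Q);
  sn_linearl : forall k l (c : R) P P' Q,
    mvfield k P -> mvfield k P' -> mvfield l Q -> forall x s,
    SN (mv_comb c P P') Q x s = c * SN P Q x s + SN P' Q x s;
  sn_linearr : forall k l (c : R) P Q Q',
    mvfield k P -> mvfield l Q -> mvfield l Q' -> forall x s,
    SN P (mv_comb c Q Q') x s = c * SN P Q x s + SN P Q' x s;
  sn_fun : forall f g : M -> R, smooth f -> smooth g -> forall x s,
    SN (mv_of_fun f) (mv_of_fun g) x s = 0;
  sn_lie : forall k a P, smooth_section a -> mvfield k P ->
    is_lie_mv k a P (SN (mv_of_section a) P);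
  sn_sym : forall k l P Q, mvfield k P -> mvfield l Q -> forall x s,
    SN P Q x s = (-1) ^+ (k * l) * SN Q P x s;
  sn_leibniz : forall k l m P Q S,
    mvfield k P -> mvfield l Q -> mvfield m S -> forall x s,
    SN P (wedge Q S) x s =
      wedge (SN P Q) S s + (-1) ^+ (k.+1 * l) * wedge Q (SN P S) s }.

Record jacobi_structure
    (SN : multivector A -> multivector A -> multivector A)
    (Pi : multivector A) (xi : section_of A) : Prop := JacobiStructure {
  jacobi_bivector : mvfield 2 Pi;
  jacobi_vector : smooth_section xi;
  jacobi_PiPi : forall x s, SN Pi Pi x s = 2 * wedge (mv_of_section xi) Pi s;
  jacobi_xiPi : forall x s, SN (mv_of_section xi) Pi x s = 0 }.

(** * The skew algebroid of a Jacobi structure *)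

Variables (Pi : multivector A) (xi : section_of A).

Definition d_rho (f : M -> R) : section_of (dual A) :=
  fun x => linfun (fun v : A x => rho v f : R^o).

Definition sharp x (al : dual A x) : A x :=
  xget 0 [set v | forall be : dual A x, be v = Pi [:: al; be]].

Definition koszul : bracket (dual A) := fun al be x =>
  lie_form (fun y => sharp (al y)) be x -
  lie_form (fun y => sharp (be y)) al x -
  d_rho (fun y => Pi [:: al y; be y]) x.

Definition sharp_jacobi x (al : dual A x) : A x :=
  sharp al + (al (xi x) : R) *: xi x.

Definition anchor_jacobi : anchor (dual A) :=
  fun x al => rho (sharp_jacobi al).

Definition bracket_jacobi (lam : section_of (dual A)) : bracket (dual A) :=
  fun al be x =>
    koszul al be x
    + (al x (xi x) : R) *: (lie_form xi be x - be x)
    - (be x (xi x) : R) *: (lie_form xi al x - al x)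
    - Pi [:: al x; be x] *: lam x.

End Multivectors.

(* Main.v *)
Require Import Defs.
From HB Require Import structures.
From mathcomp Require Import all_boot all_order all_algebra.
From mathcomp Require Import all_classical all_reals all_analysis.
From mathcomp Require Import ring lra.

Import Order.TTheory GRing.Theory Num.Theory.
Import numFieldNormedType.Exports.
Local Open Scope classical_set_scope.
Local Open Scope ring_scope.

Set Implicit Arguments.
Unset Strict Implicit.
Unset Printing Implicit Defensive.

(** Everything rests on one identity between sections of A, valid for every
    lam and for all alpha, beta:

      #J [alpha, beta]^lam = [#J alpha, #J beta] + Pi(alpha, beta) (xi - #J lam),

    where #J alpha = # alpha + alpha(xi) xi and # is the sharp map of Pi
    ([sharp_jacobi_bracket]).  Applying the anchor rho, which preserves
    brackets, the defect of rho o #J from being a bracket morphism is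
    Pi(alpha, beta) rho(xi - #J lam).  It vanishes when xi - #J lam lies in the
    kernel of rho; conversely, at a point where Pi is not zero, alpha and beta
    can be chosen with Pi(alpha, beta) <> 0 there.

    The identity is checked by pairing with a covector field gamma, after which
    it is an identity between functions.  It needs two consequences of the
    Jacobi conditions.  The condition L_xi Pi = 0 says
      xi . Pi(alpha, beta) = beta([xi, # alpha]) - alpha([xi, # beta])
    ([jacobi_act]).  The condition [Pi, Pi] = 2 xi ^ Pi says that the cyclic sum
    of (# gamma) . Pi(alpha, beta) - gamma([# alpha, # beta]) is
    (xi ^ Pi)(alpha, beta, gamma) ([jacobi_br]).

    The second one requires a formula for the Schouten bracket, which is known
    only through its axioms.  [schouten_bivectors] expresses [P, Q], for any two
    bivector fields, as a cyclic sum of terms in P, Q, their sharp maps, the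
    anchor and the bracket.  Both sides are linear in Q and depend only on the
    germ of Q, so it is enough to treat Q = a ^ b with a and b global sections,
    where the Leibniz rule reduces [P, a ^ b] to the Lie derivatives of P along
    a and b.

    Bump functions make the passage between germs and global objects
    possible.  They give the locality of the anchor, of the bracket and of the
    Schouten bracket, the global sections through every vector, the existence
    and uniqueness of the covector that defines a Lie derivative, and the
    criterion that a section is smooth as soon as its pairings are.  They are
    built from exp(-1/t) in a chart. *)

(** * Calculus of functions of class Ck on open sets *)

(** Differentiability is a property of germs: the little-o expansion of [f] at
    [x] is also one of [g]. *)
Lemma near_eq_differentiable (K : numFieldType) (V W : normedModType K)
    (f g : V -> W) (x : V) :
  (\near x, f x = g x) -> differentiable f x -> differentiable g x.
Proof.
move=> fg df; have [dfc dfE] := (diff_locallyP _ _).1 df.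
have gE : g \o shift x = cst (g x) + 'd f x +o_ 0 id.
  apply/eqaddoP => e e0.
  have /eqaddoP/(_ e e0) := dfE.
  have fg0 : \forall h \near 0, f (h + x) = g (h + x).
    rewrite (near_shift x) /=.
    by near=> h; rewrite /= sub0r addrNK; near: h; exact: fg.
  rewrite -(nbhs_singleton fg).
  by move=> H; near=> h; rewrite !fctE /= -(near fg0 h) //; near: h.
by apply/diff_locallyP; rewrite (diff_unique dfc gE).
Unshelve. all: by end_near. Qed.

Section CkCalculus.
Variables (R : realType) (n : nat).
Implicit Types (U V : set 'rV[R]_n) (f g : 'rV[R]_n -> R).

(** [Ck_on] is a pointwise condition, which makes restriction and gluing
    immediate. *)
Lemma Ck_onP k U f : Ck_on k U f <-> forall y, U y -> Ck_on k [set y] f.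
Proof.
elim: k U f => [|k IH] U f /=.
  by split=> [H y Uy _ ->|H y Uy]; [exact: H|exact: (H y Uy y)].
split=> [[H1 H2] y Uy|H].
  by split=> [_ ->|v]; [exact: H1|exact: (IH _ _).1 (H2 v) _ Uy].
split=> [y Uy|v]; first by case: (H y Uy) => + _; apply.
by apply/IH => y Uy; case: (H y Uy).
Qed.

Lemma Ck_on_sub k U V f : U `<=` V -> Ck_on k V f -> Ck_on k U f.
Proof. by move=> UV /Ck_onP H; apply/Ck_onP => y /UV; exact: H. Qed.

(** Directional derivatives at a point of an open set only see the values on
    that set, so the regularity passes to every function that agrees there. *)
Lemma Ck_on_eq k U f g : open U -> (forall y, U y -> f y = g y) ->
  Ck_on k U f -> Ck_on k U g.
Proof.
move=> oU; elim: k f g => [|k IH] f g fg.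
  move=> fc y Uy; have fgn : \near y, f y = g y.
    by apply: filterS (open_nbhs_nbhs (conj oU Uy)).
  suff : g z @[z --> y] --> f y by rewrite (fg y Uy).
  apply: cvg_trans (fc y Uy).
  exact: (near_eq_cvg fgn).
move=> [H1 H2]; have fgn y : U y -> \near y, f y = g y.
  by move=> Uy; apply: filterS (open_nbhs_nbhs (conj oU Uy)).
split=> [y Uy|v].
  exact: near_eq_differentiable (fgn y Uy) (H1 y Uy).
by apply: IH (H2 v) => y Uy; exact: near_eq_derive (fgn y Uy).
Unshelve. all: by end_near. Qed.

Lemma Ck_onS k U f : Ck_on k.+1 U f -> Ck_on k U f.
Proof.
elim: k f => [|k IH] f [H1 H2]; first by move=> y /H1/differentiable_continuous.
by split=> // v; exact: IH.
Qed.

Lemma Ck_on_cst k U (c : R) : Ck_on k U (cst c).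
Proof.
elim: k c => [|k IH] c; first by move=> y _; exact: cst_continuous.
split=> [y _|v]; first exact: differentiable_cst.
by have -> : (fun y => 'D_v (cst c) y) = cst 0 by apply/funext => y; rewrite derive_cst.
Qed.

Lemma Ck_on_coord k U j : Ck_on k U (fun y : 'rV[R]_n => y 0 j).
Proof.
case: k => [|k]; first by move=> y _; exact: coord_continuous.
split=> [y _|v]; first exact: differentiable_coord.
have -> : (fun y => 'D_v (fun y : 'rV[R]_n => y 0 j) y) = cst (v 0 j).
  apply/funext => y; rewrite deriveE; last exact: differentiable_coord.
  have @l : {linear 'rV[R]_n -> R}.
    by exists (fun N : 'M[R]_(_, _) => N 0 j); do 2![eexists]; do ?[constructor];
      rewrite ?mxE// => ? *; rewrite ?mxE//; move=> ?; rewrite !mxE.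
  by rewrite (_ : (fun _ => _) = l) // diff_lin //; exact: coord_continuous.
exact: Ck_on_cst.
Qed.

Lemma Ck_onD k U f g : open U ->
  Ck_on k U f -> Ck_on k U g -> Ck_on k U (fun y => f y + g y).
Proof.
move=> oU; elim: k f g => [|k IH] f g.
  by move=> fc gc y Uy; exact: continuousD (fc y Uy) (gc y Uy).
move=> [f1 f2] [g1 g2]; split=> [y Uy|v].
  exact: differentiableD (f1 y Uy) (g1 y Uy).
apply: Ck_on_eq (IH _ _ (f2 v) (g2 v)) => // y Uy.
by rewrite deriveD //; apply: diff_derivable; [exact: f1|exact: g1].
Qed.

Lemma Ck_onM k U f g : open U ->
  Ck_on k U f -> Ck_on k U g -> Ck_on k U (fun y => f y * g y).
Proof.
move=> oU; elim: k f g => [|k IH] f g.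
  by move=> fc gc y Uy; exact: continuousM (fc y Uy) (gc y Uy).
move=> fk gk; have [f1 f2] := fk; have [g1 g2] := gk; split=> [y Uy|v].
  exact: differentiableM (f1 y Uy) (g1 y Uy).
have fg := Ck_onD oU (IH _ _ (Ck_onS fk) (g2 v)) (IH _ _ (Ck_onS gk) (f2 v)).
apply: Ck_on_eq fg => // y Uy.
by rewrite deriveM //; apply: diff_derivable; [exact: f1|exact: g1].
Qed.

(** The family [D] of the successive derivatives is part of the witness, so that
    smoothness can be proved by closing a set of functions under derivation. *)
Definition smooth_line (h : R -> R) : Prop := exists2 D : nat -> R -> R,
  D 0%N = h & forall k (t : R), is_derive t (1 : R) (D k) (D k.+1 t).

(** The chain rule turns a derivative of [D m \o f] into a product of
    [D m.+1 \o f] and a derivative of [f]; the induction on the order of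
    differentiability therefore runs over all the [D m] at once. *)
Lemma Ck_on_comp k U h f : open U -> smooth_line h ->
  Ck_on k U f -> Ck_on k U (fun y => h (f y)).
Proof.
move=> oU [D <- DE].
suff gen m : Ck_on k U f -> Ck_on k U (fun y => D m (f y)) by exact: gen.
have Dd i t : differentiable (D i) t.
  by apply/derivable1_diffP; have [] := DE i t.
elim: k m f => [|k IH] m f.
  move=> fc y Uy; 
  exact: (@continuous_comp _ _ _ f (D m) y (fc y Uy)
    (differentiable_continuous (Dd m _))).
move=> fk; have [f1 f2] := fk; split=> [y Uy|v].
  exact: differentiable_comp (f1 y Uy) (Dd m _).
apply: Ck_on_eq (Ck_onM oU (IH m.+1 _ (Ck_onS fk)) (f2 v)) => // y Uy.
have dc := differentiable_comp (f1 y Uy) (Dd m (f y)).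
rewrite [RHS](deriveE v dc) diff_comp ?f1 //; last exact: f1.
rewrite [in RHS]/= -(deriveE _ (f1 y Uy)) diff1E //.
rewrite derive1E; have [_ ->] := DE m (f y).
by rewrite mulrC.
Qed.

End CkCalculus.

(** * A smooth step function on the line *)

Section SmoothLine.
Variable R : realType.
Implicit Types (p : {poly R}) (t : R).

(** The functions [p(1/t) exp(-1/t)], extended by zero; they are closed under
    derivation, and [p = 1] gives the usual flat function. *)
Definition flat_exp p t : R :=
  if 0 < t then p.[t^-1] * expR (- t^-1) else 0.

Lemma pow_expRN_bounded m (u : R) : 0 < u -> u ^+ m * expR (- u) <= m`!%:R.
Proof.
move=> u0; rewrite expRN ler_pdivrMr ?expR_gt0 //.
have fa0 : (0 : R) < m`!%:R by rewrite ltr0n fact_gt0.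
rewrite mulrC -ler_pdivrMr //; case: m fa0 => [|m] fa0.
  by rewrite expr0 divr1 ltW // expR_gt1.
by apply: le_trans (expR_ge1Dxn m (ltW u0)); rewrite lerDr.
Qed.

(** The exponential beats polynomials; this is what makes [flat_exp] flat at 0. *)
Lemma poly_expRN_bounded p : exists C : R, forall u : R, 0 < u ->
  `|p.[u]| * expR (- u) <= C.
Proof.
(* the extra power of [u] lets Horner's decomposition go through *)
suff gen m : exists C : R, forall u : R, 0 < u ->
    `|p.[u]| * (u ^+ m * expR (- u)) <= C.
  by have [C HC] := gen 0%N; exists C => u /HC; rewrite expr0 mul1r.
elim/poly_ind: p m => [|p c IH] m.
  by exists 0 => u u0; rewrite horner0 normr0 mul0r.
have [C HC] := IH m.+1; exists (C + `|c| * m`!%:R) => u u0.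
rewrite hornerMXaddC.
have e0 : 0 <= u ^+ m * expR (- u) by rewrite mulr_ge0 ?expR_ge0 // exprn_ge0 // ltW.
apply: le_trans (ler_wpM2r e0 (ler_normD _ _)) _.
rewrite mulrDl lerD //; last by rewrite ler_wpM2l // pow_expRN_bounded.
by rewrite normrM (gtr0_norm u0) -mulrA (mulrA u) -exprS; exact: HC.
Qed.

(** Away from 0 this is the derivative of [p(1/t) exp(-1/t)].  At 0 the
    difference quotient is [h] times a function of the same family, and such
    functions are bounded. *)
Lemma is_derive_flat_exp p t :
  is_derive t (1 : R) (flat_exp p) (flat_exp ('X^2 * (p - p^`())) t).
Proof.
rewrite {2}/flat_exp; case: ltrgt0P => [t0|t0|->].
- apply: (@near_eq_is_derive _ _ _ (fun t => p.[t^-1] * expR (- t^-1))).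
    near=> s; rewrite /flat_exp ifT //; near: s; exact: lt_nbhsr.
  have tn0 : t != 0 by rewrite gt_eqF.
  have dI : is_derive t (1 : R) (fun s => s^-1) (- t ^- 2).
    by have := @is_deriveV R id t 1 1 tn0 (is_derive_id _ _); rewrite scaler1.
  have dN : is_derive t (1 : R) (fun s : R => - s^-1) (t ^- 2).
    by have := is_deriveN dI; rewrite opprK.
  have d1 := @is_derive1_comp R (horner p) (fun s => s^-1) t _ _ (is_derive_poly p _) dI.
  have d2 := @is_derive1_comp R expR (fun s => - s^-1) t _ _ (is_derive_expR _) dN.
  apply: is_derive_eq (is_deriveM d1 d2) _.
  rewrite !hornerE /= /GRing.scale /= exprVn; ring.
- apply: (@near_eq_is_derive _ _ _ (cst 0)).
  by near=> s; rewrite /flat_exp ltNge ltW //; near: s; exact: lt_nbhsl.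
- have [C HC] := poly_expRN_bounded ('X^2 * p).
  have C0 : 0 <= C by apply: le_trans (HC 1 ltr01); rewrite mulr_ge0 // expR_ge0.
  have C1 : 0 < C + 1 by rewrite ltr_wpDl.
  have lim0 : (fun h => h^-1 *: (flat_exp p (h *: (1 : R) + 0) - flat_exp p 0))
      @ 0^' --> (0 : R).
    apply/cvgr0Pnorm_le => e e0; near=> h.
    rewrite /flat_exp ltxx subr0 addr0 /GRing.scale /= mulr1.
    case: ifP => h0; last by rewrite mulr0 normr0 ltW.
    have hV0 : 0 < h^-1 by rewrite invr_gt0.
    have := HC _ hV0; rewrite hornerM hornerXn normrM (gtr0_norm (exprn_gt0 _ hV0)) => H.
    rewrite !normrM (gtr0_norm hV0) (gtr0_norm (expR_gt0 _)).
    apply: (@le_trans _ _ (h * C)).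
      apply: le_trans (ler_wpM2l (ltW h0) H).
      by rewrite le_eqVlt; apply/orP; left; apply/eqP; field; rewrite gt_eqF.
    apply: (@le_trans _ _ (h * (C + 1))); first by rewrite ler_pM2l // lerDl.
    rewrite -ler_pdivlMr // ltW //.
    have -> : h = `|h - 0| by rewrite subr0 gtr0_norm.
    rewrite distrC; near: h; apply: nbhs_dnbhs; apply: nbhsx_ballx.
    by rewrite divr_gt0.
  by apply: DeriveDef; [apply/cvg_ex; exists 0|exact: cvg_lim].
Unshelve. all: by end_near. Qed.

Definition expRNV : R -> R := flat_exp 1.

Lemma smooth_expRNV : smooth_line expRNV.
Proof.
exists (fun k => flat_exp (iter k (fun p => 'X^2 * (p - p^`())) 1)) => // k t.
exact: is_derive_flat_exp.
Qed.

Lemma expRNV_le0 t : t <= 0 -> expRNV t = 0.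
Proof. by move=> t0; rewrite /expRNV /flat_exp ltNge t0. Qed.

Lemma expRNV_gt0 t : 0 < t -> 0 < expRNV t.
Proof. by move=> t0; rewrite /expRNV /flat_exp t0 hornerC mul1r expR_gt0. Qed.

Lemma expRNV_ge1 t : 1 <= t -> expRNV 1 <= expRNV t.
Proof.
move=> t1; have t0 := lt_le_trans ltr01 t1.
rewrite /expRNV /flat_exp ltr01 t0 !hornerC !mul1r ler_expR lerN2.
by rewrite invr1 invf_le1.
Qed.

(** A composition of two flat functions, so that no quotient of smooth functions
    has to be differentiated: the inner one is 0 for [t <= 0] and at least its
    value at 1 for [1 <= t], where the outer one vanishes. *)
Definition step t : R := (expRNV (expRNV 1))^-1 * expRNV (expRNV 1 - expRNV t).

Lemma step_le0 t : t <= 0 -> step t = 1.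
Proof.
move=> t0; rewrite /step (expRNV_le0 t0) subr0 mulVf // gt_eqF //.
by do 2 apply: expRNV_gt0.
Qed.

Lemma step_ge1 t : 1 <= t -> step t = 0.
Proof.
by move=> t1; rewrite /step [X in _ * X]expRNV_le0 ?mulr0 // subr_le0 expRNV_ge1.
Qed.

Lemma Ck_on_step n k (U : set 'rV[R]_n) (f : 'rV[R]_n -> R) : open U ->
  Ck_on k U f -> Ck_on k U (fun y => step (f y)).
Proof.
move=> oU fk; apply: Ck_onM => //; first exact: Ck_on_cst.
apply: (Ck_on_comp oU smooth_expRNV (f := fun y => expRNV 1 - expRNV (f y))).
rewrite (_ : (fun y => _) = fun y => expRNV 1 + (-1) * expRNV (f y)); last first.
  by apply/funext => y; rewrite mulN1r.
apply: Ck_onD => //; first exact: Ck_on_cst.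
apply: Ck_onM => //; first exact: Ck_on_cst.
exact: Ck_on_comp smooth_expRNV fk.
Qed.

End SmoothLine.

(** * Smooth functions on a manifold, bump functions *)

Section SmoothFunctions.
Variables (R : realType) (M : manifold R).
Implicit Types (V W : set M) (f g : M -> R).

(** Read through the inverse chart, the image of [W] is a preimage; this is how
    the openness of images of open sets follows from continuity. *)
Lemma chart_img_preimage (c : chart R (manifold_dim M) M) W :
  c @` (chart_dom c `&` W) = (c @` chart_dom c) `&` (chart_inv c @^-1` W).
Proof.
rewrite eqEsubset; split=> y.
  by move=> [x [cx Wx] <-]; split; [exists x|rewrite /= chart_mapK].
by move=> [[x cx <-]] /=; rewrite chart_mapK // => Wx; exists x.
Qed.

Lemma chart_img_open_sub (c : chart R (manifold_dim M) M) W :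
  open W -> open (c @` (chart_dom c `&` W)).
Proof.
move=> oW; rewrite chart_img_preimage openE => y [yc Wy].
apply: filterI; first by apply: open_nbhs_nbhs; split=> //; exact: chart_img_open.
exact: (chart_inv_cont yc (open_nbhs_nbhs (conj oW Wy))).
Qed.

(** Smoothness is local: charts are tested point by point. *)
Lemma smooth_on_local W f :
  (forall x, W x -> exists V, [/\ open V, V x & smooth_on V f]) ->
  smooth_on W f.
Proof.
move=> H c ca k; apply/Ck_onP => y [x [cx Wx] <-].
have [V [oV Vx Vf]] := H x Wx.
by apply: Ck_on_sub (Vf c ca k) => _ ->; exists x.
Qed.

Lemma smooth_on_sub V W f : V `<=` W -> smooth_on W f -> smooth_on V f.
Proof.
move=> VW Wf c ca k; apply: Ck_on_sub (Wf c ca k).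
by move=> _ [x [cx Vx] <-]; exists x => //; split=> //; exact: VW.
Qed.

Lemma smooth_smooth_on W f : smooth f -> smooth_on W f.
Proof. exact: smooth_on_sub. Qed.

Lemma smooth_on_eq W f g : open W -> (forall x, W x -> f x = g x) ->
  smooth_on W f -> smooth_on W g.
Proof.
move=> oW fg Wf c ca k; apply: Ck_on_eq (Wf c ca k).
  exact: chart_img_open_sub.
by move=> _ [x [cx Wx] <-] /=; rewrite chart_mapK // fg.
Qed.

Lemma smooth_on_cst W (a : R) : smooth_on W (fun=> a).
Proof. by move=> c ca k; exact: Ck_on_cst. Qed.

Lemma smooth_onD W f g : open W -> smooth_on W f -> smooth_on W g ->
  smooth_on W (fun x => f x + g x).
Proof.
move=> oW Wf Wg c ca k; apply: Ck_onD; [exact: chart_img_open_sub|exact: Wf|exact: Wg].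
Qed.

Lemma smooth_onM W f g : open W -> smooth_on W f -> smooth_on W g ->
  smooth_on W (fun x => f x * g x).
Proof.
move=> oW Wf Wg c ca k; apply: Ck_onM; [exact: chart_img_open_sub|exact: Wf|exact: Wg].
Qed.

Lemma smooth_on_sum (I : Type) (r : seq I) W (F : I -> M -> R) : open W ->
  (forall i, smooth_on W (F i)) -> smooth_on W (fun x => \sum_(i <- r) F i x).
Proof.
move=> oW H; elim: r => [|i r IH].
  rewrite (_ : (fun x => _) = fun=> 0); first exact: smooth_on_cst.
  by apply/funext => x; rewrite big_nil.
rewrite (_ : (fun x => _) = fun x => F i x + \sum_(j <- r) F j x).
  exact: smooth_onD.
by apply/funext => x; rewrite big_cons.
Qed.

Lemma smooth_cst (a : R) : smooth (fun _ : M => a).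
Proof. exact: smooth_on_cst. Qed.

Lemma smoothD f g : smooth f -> smooth g -> smooth (fun x => f x + g x).
Proof. exact/smooth_onD/openT. Qed.

Lemma smoothM f g : smooth f -> smooth g -> smooth (fun x => f x * g x).
Proof. exact/smooth_onM/openT. Qed.

Lemma smoothN f : smooth f -> smooth (fun x => - f x).
Proof.
move=> fs; rewrite (_ : (fun x => _) = fun x => -1 * f x).
  by apply: smoothM => //; exact: smooth_cst.
by apply/funext => x; rewrite mulN1r.
Qed.

Lemma smoothB f g : smooth f -> smooth g -> smooth (fun x => f x - g x).
Proof. by move=> fs gs; apply: smoothD => //; exact: smoothN. Qed.

(** Around [x], compose the step function with a rescaled squared distance in a
    chart and extend by zero.  The support is the image of a closed ball, hence
    compact, hence closed in [M] because [M] is Hausdorff: this is what makes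
    the extension by zero smooth. *)
Lemma bump W (x : M) : open W -> W x -> exists chi : M -> R,
  [/\ smooth chi, exists V, [/\ open V, V x & forall y, V y -> chi y = 1]
    & exists C, [/\ closed C, C `<=` W & forall y, ~ C y -> chi y = 0]].
Proof.
move=> oW Wx; have [c ca cx] := atlas_cover x.
set p := c x; have pO : (c @` (chart_dom c `&` W)) p by exists x.
have : nbhs p (c @` (chart_dom c `&` W)).
  by apply: open_nbhs_nbhs; split=> //; exact: chart_img_open_sub.
move=> /nbhs_closedballP[e].
rewrite closed_ballE // => eW; set K := closed_ball_ Num.norm p e%:num in eW.
have Kc : compact K.
  apply: bounded_closed_compact; last exact: closed_closed_ball_.
  exists (`|p| + e%:num); split; first exact: num_real.
  move=> N pN y Ky; apply: (le_trans _ (ltW pN)).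
  rewrite -[y in `|y|](subKr p) (le_trans (ler_normB _ _)) // lerD2l; exact: Ky.
have KW y : K y -> [/\ (c @` chart_dom c) y, W (chart_inv c y)
    & chart_dom c (chart_inv c y)].
  by move=> /eW[z [cz Wz] <-]; rewrite chart_mapK //; split=> //; exists z.
pose C := chart_inv c @` K.
have Cc : closed C.
  apply: compact_closed; first exact: manifold_hausdorff.
  apply: continuous_compact => //.
  apply: continuous_in_subspaceT => y; rewrite inE => Ky.
  by apply: chart_inv_cont; have [] := KW y Ky.
(* negative near [p], and at least 1 outside [K] *)
pose q (y :  'rV[R]_(manifold_dim M)) : R :=
  2 * (e%:num ^+ 2)^-1 * (\sum_j (y 0 j - p 0 j) ^+ 2) - 1.
pose g y := step (q y).
have gK y : ~ K y -> g y = 0.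
  move=> /negP; rewrite /K /closed_ball_ /= -ltNge => Ky; apply: step_ge1.
  rewrite /q lerBrDr.
  suff : e%:num ^+ 2 <= \sum_j (y 0 j - p 0 j) ^+ 2.
    by rewrite -mulrA ler_pMr // mulrC ler_pdivlMr ?mul1r // exprn_gt0.
  have /mx_norm_neq0[[i j] ij] : mx_norm (p - y) != 0.
    by rewrite gt_eqF //; exact: lt_trans Ky.
  have {Ky ij} : e%:num < `|(p - y) i j| by rewrite -ij.
  rewrite !mxE (ord1 i) distrC => Ky.
  rewrite (bigD1 j) //= ler_wpDr ?sumr_ge0 // => [k _|]; first exact: sqr_ge0.
  by rewrite -[leRHS]real_normK ?num_real // ler_sqr ?nnegrE // ltW.
have qs k (f : 'rV[R]_(manifold_dim M) -> 'rV[R]_(manifold_dim M)) U : open U ->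
    (forall j, Ck_on k U (fun y => f y 0 j)) -> Ck_on k U (fun y => q (f y)).
  move=> oU fk; apply: Ck_onD => //; last exact: Ck_on_cst.
  apply: Ck_onM => //; first exact: Ck_on_cst.
  elim: (index_enum _) => [|j r IH].
    rewrite (_ : (fun x => _) = cst 0); first exact: Ck_on_cst.
    by apply/funext => y; rewrite big_nil.
  rewrite (_ : (fun x => _) = fun y => (f y 0 j - p 0 j) * (f y 0 j - p 0 j) +
     \sum_(j <- r) (f y 0 j - p 0 j) ^+ 2); last first.
    by apply/funext => y; rewrite big_cons expr2.
  have fj : Ck_on k U (fun y => f y 0 j - p 0 j).
    by apply: Ck_onD => //; exact: Ck_on_cst.
  by apply: Ck_onD => //; exact: Ck_onM.
pose chi y := if `[< chart_dom c y >] then g (c y) else 0.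
have chiC y : ~ C y -> chi y = 0.
  move=> Cy; rewrite /chi; case: asboolP => // cy; apply: gK => Kcy.
  by apply: Cy; exists (c y) => //; rewrite chart_mapK.
exists chi; split.
- apply: smooth_on_local => y _.
  have [cy|cy] := pselect (chart_dom c y); last first.
    exists (~` C); split; first exact: closed_openC.
      by move=> [z Kz zy]; apply: cy; rewrite -zy; have [] := KW z Kz.
    apply: (smooth_on_eq (f := fun=> 0)); [exact: closed_openC| |exact: smooth_on_cst].
    by move=> z Cz; rewrite chiC.
  exists (chart_dom c); split=> //; first exact: chart_dom_open.
  apply: (smooth_on_eq (f := fun y => g (c y))); first exact: chart_dom_open.
    by move=> z cz; rewrite /chi asboolT.
  move=> d da k; apply: Ck_on_step; first exact/chart_img_open_sub/chart_dom_open.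
  apply: (qs k (fun y => c (chart_inv d y))).
    exact/chart_img_open_sub/chart_dom_open.
  by move=> j; exact: atlas_smooth.
- have qc : continuous q.
    move=> y; apply: (qs 0%N id setT openT _ y I) => i; exact: Ck_on_coord.
  exists (chart_dom c `&` [set y | q (c y) < 0]); split.
  + rewrite openE => y [cy qy]; apply: filterI.
      by apply: open_nbhs_nbhs; split=> //; exact: chart_dom_open.
    have H : (q \o c) z @[z --> y] --> q (c y).
      exact: (continuous_comp (chart_map_cont cy) (qc (c y))).
    have : nbhs (q (c y)) [set r | r < 0].
      by apply: open_nbhs_nbhs; split=> //; exact: open_lt.
    by move/H.
  + split=> //=; rewrite /q big1 => [|j _]; first by rewrite mulr0 add0r ltrN10.
    by rewrite subrr expr0n.
  + by move=> y [cy /= /ltW qy]; rewrite /chi asboolT // /g step_le0.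
- exists C; split=> // y [z Kz <-]; by have [] := KW z Kz.
Qed.
End SmoothFunctions.

(** * Smooth sections and their pairings *)

Section Pairing.
Variables (R : realType) (M : manifold R) (E : vbundle M) (x : M).
Implicit Types (al be : dual E x) (v w : E x).

(** The evaluation of a covector on a vector, typed in [R] and not in the
    regular module [R^o], so that the ring operations on values are those of
    [R]. *)
Definition pair al v : R := al v.

Lemma pairDr al v w : pair al (v + w) = pair al v + pair al w.
Proof. exact: linearD. Qed.
Lemma pairZr al c v : pair al (c *: v) = c * pair al v.
Proof. exact: linearZ. Qed.
Lemma pairNr al v : pair al (- v) = - pair al v.
Proof. exact: linearN. Qed.
Lemma pair0r al : pair al 0 = 0.
Proof. exact: linear0. Qed.
Lemma pairBr al v w : pair al (v - w) = pair al v - pair al w.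
Proof. exact: linearB. Qed.
Lemma pair_sumr al (I : Type) (r : seq I) (F : I -> E x) :
  pair al (\sum_(i <- r) F i) = \sum_(i <- r) pair al (F i).
Proof. exact: linear_sum. Qed.
Lemma pairDl al be v : pair (al + be) v = pair al v + pair be v.
Proof. exact: add_lfunE. Qed.
Lemma pairZl al c v : pair (c *: al) v = c * pair al v.
Proof. exact: scale_lfunE. Qed.
Lemma pairNl al v : pair (- al) v = - pair al v.
Proof. exact: opp_lfunE. Qed.
Lemma pair0l v : pair 0 v = 0.
Proof. exact: zero_lfunE. Qed.
Lemma pairBl al be v : pair (al - be) v = pair al v - pair be v.
Proof. by rewrite pairDl pairNl. Qed.
Lemma pair_suml (I : Type) (r : seq I) (F : I -> dual E x) v :
  pair (\sum_(i <- r) F i) v = \sum_(i <- r) pair (F i) v.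
Proof. exact: sum_lfunE. Qed.

Lemma pair_injl al be : (forall v, pair al v = pair be v) -> al = be.
Proof. by move=> H; apply/lfunP. Qed.

(** Covectors separate vectors: the coordinates in a frame are covectors. *)
Lemma pair_injr v w : (forall al, pair al v = pair al w) -> v = w.
Proof.
move=> H; have [i xi] := frame_cover E x; have bi := frame_basis xi.
rewrite (coord_basis bi (memvf v)) (coord_basis bi (memvf w)).
apply: eq_bigr => k _; congr (_ *: _).
by have := H (tnth (dual_frame i x) k); rewrite /pair tnth_mktuple !lfunE.
Qed.

Definition pairlE := (pairDl, pairBl, pairZl, pairNl, pair0l).
Definition pairrE := (pairDr, pairBr, pairZr, pairNr, pair0r).

End Pairing.

Section Sections.
Variables (R : realType) (M : manifold R) (E : vbundle M).
Implicit Types (s t b : section_of E) (V W : set M).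

Lemma coord_frame i x (k l : 'I_(rank E)) : @frame_dom _ _ E i x ->
  coord (frame i x) k (tnth (frame i x) l) = (l == k)%:R.
Proof.
by move=> xi; rewrite (tnth_nth 0) coord_free //; exact: basis_free (frame_basis xi).
Qed.

(** The coefficients in a frame are unique, so they can be taken to be the
    coordinates. *)
Lemma smooth_sectionP s : smooth_section s <->
  forall i k, smooth_on (@frame_dom _ _ E i) (fun x => coord (frame i x) k (s x)).
Proof.
split=> [ss i k|H i].
  have [c cs cE] := ss i.
  apply: smooth_on_eq (cs k); first exact: frame_dom_open.
  move=> x xi; rewrite cE // linear_sum (bigD1 k) //= big1 => [|l lk].
    by rewrite linearZ /= coord_frame // eqxx mulr1 addr0.
  by rewrite linearZ /= coord_frame // (negbTE lk) mulr0.
exists (fun k x => coord (frame i x) k (s x)) => // x xi.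
rewrite {1}(coord_basis (frame_basis xi) (memvf (s x))).
by apply: eq_bigr => k _; rewrite -tnth_nth.
Qed.

Lemma smooth_section_comb (f g : M -> R) s t : smooth f -> smooth g ->
  smooth_section s -> smooth_section t ->
  smooth_section (fun x => f x *: s x + g x *: t x).
Proof.
move=> fs gs /smooth_sectionP ss /smooth_sectionP ts; apply/smooth_sectionP => i k.
have oi := @frame_dom_open _ _ E i.
apply: (smooth_on_eq (f := fun x => f x * coord (frame i x) k (s x) +
    g x * coord (frame i x) k (t x))) => //.
  by move=> x xi; rewrite linearD !linearZ.
by apply: smooth_onD => //; apply: smooth_onM => //; exact: smooth_smooth_on.
Qed.

Lemma smooth_sectionD s t : smooth_section s -> smooth_section t ->
  smooth_section (fun x => s x + t x).
Proof.
move=> ss ts; have one := smooth_cst (M := M) 1.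
have := smooth_section_comb one one ss ts.
by congr smooth_section; apply/functional_extensionality_dep => x; rewrite !scale1r.
Qed.

Lemma smooth_sectionZ (f : M -> R) s : smooth f -> smooth_section s ->
  smooth_section (fun x => f x *: s x).
Proof.
move=> fs ss; have := smooth_section_comb fs (smooth_cst (M := M) 0) ss ss.
congr smooth_section; apply/functional_extensionality_dep => x.
by rewrite scale0r addr0.
Qed.

Lemma smooth_section0 : smooth_section (fun x => 0 : E x).
Proof.
apply/smooth_sectionP => i k; rewrite (_ : (fun x => _) = fun=> 0).
  exact: smooth_on_cst.
by apply/funext => x; rewrite linear0.
Qed.

Lemma smooth_section_sum (I : Type) (r : seq I) (F : I -> section_of E) :
  (forall i, smooth_section (F i)) ->
  smooth_section (fun x => \sum_(i <- r) F i x).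
Proof.
move=> H; elim: r => [|i r IH].
  rewrite (_ : (fun x => _) = fun x => 0); first exact: smooth_section0.
  by apply/functional_extensionality_dep => x; rewrite big_nil.
rewrite (_ : (fun x => _) = fun x => F i x + \sum_(j <- r) F j x).
  exact: smooth_sectionD.
by apply/functional_extensionality_dep => x; rewrite big_cons.
Qed.

(** A product with a function supported in [W] is smooth wherever the other
    factor is smooth on [W]: outside the support it vanishes. *)
Lemma smooth_on_cutoff (chi f : M -> R) (C V W : set M) :
  open V -> open W -> smooth chi ->
  closed C -> C `<=` W -> (forall y, ~ C y -> chi y = 0) ->
  smooth_on (V `&` W) f -> smooth_on V (fun x => chi x * f x).
Proof.
move=> oV oW chis cC CW chi0 fs; apply: smooth_on_local => x Vx.
have [Cx|Cx] := pselect (C x).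
  exists (V `&` W); split; [exact: openI|by split=> //; exact: CW|].
  by apply: smooth_onM => //; [exact: openI|exact: smooth_smooth_on].
exists (~` C); split=> //; first exact: closed_openC.
apply: (smooth_on_eq (f := fun=> 0)); [exact: closed_openC| |exact: smooth_on_cst].
by move=> z Cz; rewrite chi0 // mul0r.
Qed.

Lemma smooth_cutoff_frame i k (chi : M -> R) (C : set M) :
  smooth chi -> closed C -> C `<=` @frame_dom _ _ E i ->
  (forall y, ~ C y -> chi y = 0) ->
  smooth_section (fun x => chi x *: tnth (frame i x) k : E x).
Proof.
move=> chis cC CW chi0; apply/smooth_sectionP => j l.
have [g gs gE] := frame_smooth (v := E) i j.
apply: (smooth_on_eq (f := fun x => chi x * g k l x)).
- exact: frame_dom_open.
- move=> x xj; rewrite linearZ /=; have [Cx|Cx] := pselect (C x); last first.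
    by rewrite chi0 // !mul0r.
  rewrite (gE x (CW _ Cx) xj) linear_sum (bigD1 l) //= big1 => [|m ml].
    by rewrite linearZ /= coord_frame // eqxx mulr1 addr0.
  by rewrite linearZ /= coord_frame // (negbTE ml) mulr0.
- apply: (smooth_on_cutoff (C := C) (W := @frame_dom _ _ E i)) => //;
    try exact: frame_dom_open.
  by rewrite setIC; exact: gs.
Qed.

(** A frame cut off by a bump function: global sections that form the given
    frame near a point. *)
Lemma local_frame i (x : M) : @frame_dom _ _ E i x ->
  exists (e : 'I_(rank E) -> section_of E) V,
  [/\ open V, V x, V `<=` @frame_dom _ _ E i, forall k, smooth_section (e k)
    & forall y, V y -> forall k, e k y = tnth (frame i y) k].
Proof.
move=> xi.
have [chi [chis [V [oV Vx V1]] [C [cC CW C0]]]] := bump (@frame_dom_open _ _ E i) xi.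
exists (fun k y => chi y *: tnth (frame i y) k), (V `&` @frame_dom _ _ E i).
split=> //; first by apply: openI => //; exact: frame_dom_open.
  by move=> k; exact: smooth_cutoff_frame C0.
by move=> y [/V1 -> _] k; rewrite scale1r.
Qed.

Lemma section_through (x : M) (v : E x) :
  exists2 s : section_of E, smooth_section s & s x = v.
Proof.
have [i xi] := frame_cover E x.
have [e [V [_ Vx Vi es eE]]] := local_frame xi.
exists (fun y => \sum_k (coord (frame i x) k v) *: e k y).
  by apply: smooth_section_sum => k; apply: smooth_sectionZ (es k); exact: smooth_cst.
rewrite [RHS](coord_basis (frame_basis (Vi _ Vx)) (memvf v)).
by apply: eq_bigr => k _; rewrite eE // -tnth_nth.
Qed.

(** A functional on global sections that is linear over smooth functions,
    evaluated at [x], only depends on the value at [x].  Multiplying [s] by the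
    square of a bump function does not change the value and writes it as a
    combination of global sections with global coefficients. *)
Lemma tensorial_covector (x : M) (T : section_of E -> R) :
  (forall s t, smooth_section s -> smooth_section t ->
    T (fun y => s y + t y) = T s + T t) ->
  (forall f s, smooth f -> smooth_section s ->
    T (fun y => f y *: s y) = f x * T s) ->
  exists theta : dual E x, forall s, smooth_section s -> T s = pair theta (s x).
Proof.
move=> TD TZ; have T0 : T (fun=> 0) = 0.
  have := TZ (fun=> 0) _ (smooth_cst (M := M) 0) smooth_section0.
  rewrite mul0r => <-; congr T.
  by apply/functional_extensionality_dep => y; rewrite scale0r.
have [i xi] := frame_cover E x.
have [chi [chis [V [oV Vx V1]] [C [cC CW C0]]]] := bump (@frame_dom_open _ _ E i) xi.
pose e k : section_of E := fun y => chi y *: tnth (frame i y) k.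
have es k : smooth_section (e k) by exact: smooth_cutoff_frame C0.
exists (\sum_k T (e k) *: tnth (dual_frame i x) k) => s ss.
have chi1 : chi x = 1 by exact: V1.
pose c k y := chi y * coord (frame i y) k (s y).
have cs k : smooth (c k).
  apply: (smooth_on_cutoff openT (@frame_dom_open _ _ E i) chis cC CW C0).
  by rewrite setTI; apply: (smooth_sectionP s).1.
(* one factor [chi] for the coefficient, one for the frame *)
have -> : T s = T (fun y => \sum_k c k y *: e k y).
  have chi2 : smooth (fun y => chi y * chi y) by exact: smoothM.
  rewrite -[LHS]mul1r -[1 in LHS]mul1r -chi1 -(TZ _ _ chi2 ss); congr T.
  apply/functional_extensionality_dep => y.
  have [Cy|Cy] := pselect (C y); last first.
    rewrite C0 // mul0r scale0r big1 // => k _.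
    by rewrite /c C0 // mul0r scale0r.
  rewrite [in LHS](coord_basis (frame_basis (CW _ Cy)) (memvf (s y))) scaler_sumr.
  apply: eq_bigr => k _; rewrite /c /e !scalerA -tnth_nth; congr (_ *: _); ring.
have -> r : T (fun y => \sum_(k <- r) c k y *: e k y) = \sum_(k <- r) c k x * T (e k).
  elim: r => [|k r IH].
    rewrite big_nil -[RHS]T0; congr T.
    by apply/functional_extensionality_dep => y; rewrite big_nil.
  have rs : smooth_section (fun y => \sum_(l <- r) c l y *: e l y).
    by apply: smooth_section_sum => l; exact: smooth_sectionZ.
  rewrite big_cons -IH -(TZ _ _ (cs k) (es k)).
  rewrite -(TD _ _ (smooth_sectionZ (cs k) (es k)) rs); congr T.
  by apply/functional_extensionality_dep => y; rewrite big_cons.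
rewrite pair_suml; apply: eq_bigr => k _.
by rewrite pairZl /pair tnth_mktuple lfunE /c chi1 mul1r mulrC.
Qed.

End Sections.

Section DualSections.
Variables (R : realType) (M : manifold R) (E : vbundle M).
Implicit Types (s b : section_of E) (al : section_of (dual E)).

Lemma pair_frame i x (al : dual E x) v : frame_dom i x ->
  pair al v = \sum_k pair al (tnth (frame i x) k) * coord (frame i x) k v.
Proof.
move=> xi; rewrite {1}(coord_basis (frame_basis xi) (memvf v)) pair_sumr.
by apply: eq_bigr => k _; rewrite pairZr mulrC -tnth_nth.
Qed.

(** The coordinates of a covector in the dual frame are its values on the frame. *)
Lemma coord_dual_frame (i : frame_index E) x (k : 'I_(rank E)) (al : dual E x) : frame_dom i x ->
  coord (frame (v := dual E) i x) k al = pair al (tnth (frame i x) k).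
Proof.
move=> xi; rewrite {1}(dual_frameE al xi) linear_sum (bigD1 k) //= big1 => [|l lk].
  by rewrite linearZ /= (coord_frame (E := dual E)) // eqxx mulr1 addr0.
by rewrite linearZ /= (coord_frame (E := dual E)) // (negbTE lk) mulr0.
Qed.

Lemma smooth_pair al b : smooth_section al -> smooth_section b ->
  smooth (fun x => pair (al x) (b x)).
Proof.
move=> /smooth_sectionP als /smooth_sectionP bs; apply: smooth_on_local => x _.
have [i xi] := frame_cover E x; have oi := @frame_dom_open _ _ E i.
exists (frame_dom i); split=> //.
apply: (smooth_on_eq (f := fun y => \sum_k coord (frame (v := dual E) i y) k (al y) *
     coord (frame i y) k (b y))) => //.
  move=> y yi; rewrite (pair_frame _ _ yi).
  by apply: eq_bigr => k _; rewrite coord_dual_frame.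
apply: smooth_on_sum => // k; exact: (smooth_onM oi (als i k) (bs i k)).
Qed.

(** Near a point the coefficients of [al] are its pairings with global sections
    that extend the frame; hence smoothness can be tested on pairings. *)
Lemma smooth_dual_section al :
  (forall b, smooth_section b -> smooth (fun x => pair (al x) (b x))) ->
  smooth_section al.
Proof.
move=> H; apply/smooth_sectionP => i k; apply: smooth_on_local => x xi.
have [e [V [oV Vx Vi es eE]]] := local_frame (E := E) xi.
exists V; split=> //.
apply: (smooth_on_eq (f := fun y => pair (al y) (e k y))) => //; last first.
  by apply: smooth_smooth_on; exact: H.
by move=> y Vy; rewrite (coord_dual_frame _ _ (Vi _ Vy)) eE.
Qed.

(** The counterpart of [smooth_dual_section], with the dual frame as test
    covectors. *)
Lemma smooth_section_pair b :
  (forall al, smooth_section al -> smooth (fun x => pair (al x) (b x))) ->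
  smooth_section b.
Proof.
move=> H; apply/smooth_sectionP => i k; apply: smooth_on_local => x xi.
have [e [V [oV Vx Vi es eE]]] := local_frame (E := dual E) xi.
exists V; split=> //.
apply: (smooth_on_eq (f := fun y => pair (e k y) (b y))) => //; last first.
  by apply: smooth_smooth_on; exact: H.
by move=> y Vy; rewrite eE // /pair tnth_mktuple lfunE.
Qed.

End DualSections.

(** * Calculus in a skew algebroid, bivector fields *)

Section SkewAlgebroidCalculus.
Variables (R : realType) (M : manifold R) (A : vbundle M).
Variables (rho : anchor A) (br : bracket A).
Hypothesis skewA : skew_algebroid rho br.
Implicit Types (a b c : section_of A) (f g : M -> R).
Implicit Types (al be : section_of (dual A)).

Lemma anchor_lin x (r : R) (v w : A x) f : smooth f ->
  rho (r *: v + w) f = r * rho v f + rho w f.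
Proof. exact: (anchor_linear (skew_anchor skewA)). Qed.

Lemma anchor0 x f : smooth f -> rho (0 : A x) f = 0.
Proof.
move=> fs; have := anchor_lin 1 (0 : A x) 0 fs.
by rewrite scaler0 addr0 mul1r => /eqP; rewrite -subr_eq subrr eq_sym => /eqP.
Qed.

Lemma anchorD x (v w : A x) f : smooth f -> rho (v + w) f = rho v f + rho w f.
Proof. by move=> fs; rewrite -[v]scale1r anchor_lin // mul1r scale1r. Qed.

Lemma anchorZ x (r : R) (v : A x) f : smooth f -> rho (r *: v) f = r * rho v f.
Proof. by move=> fs; rewrite -[r *: v]addr0 anchor_lin // anchor0 // addr0. Qed.

Lemma actD a f g x : smooth f -> smooth g ->
  act rho a (fun y => f y + g y) x = act rho a f x + act rho a g x.
Proof.
move=> fs gs; have := tangent_linear (anchor_tangent (skew_anchor skewA) (a x)) 1 fs gs.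
rewrite mul1r => <-; congr rho; by apply/funext => y; rewrite mul1r.
Qed.

Lemma actM a f g x : smooth f -> smooth g ->
  act rho a (fun y => f y * g y) x = f x * act rho a g x + g x * act rho a f x.
Proof. exact: tangent_leibniz (anchor_tangent (skew_anchor skewA) (a x)) _ _. Qed.

(** The Leibniz rule applied to [1 = 1 * 1] gives the vanishing on 1. *)
Lemma act_cst a (r : R) x : act rho a (fun=> r) x = 0.
Proof.
have act1 : act rho a (fun=> 1) x = 0.
  have := actM a x (smooth_cst (M := M) 1) (smooth_cst (M := M) 1).
  by rewrite !mul1r => /eqP; rewrite -subr_eq subrr eq_sym => /eqP.
have := tangent_linear (anchor_tangent (skew_anchor skewA) (a x)) (r - 1)
  (smooth_cst (M := M) 1) (smooth_cst (M := M) 1).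
rewrite (_ : (fun y => _) = fun=> r); last by apply/funext => y; ring.
by rewrite /act in act1 *; rewrite act1 mulr0 addr0.
Qed.

Lemma actZ a f (r : R) x : smooth f ->
  act rho a (fun y => r * f y) x = r * act rho a f x.
Proof.
by move=> fs; rewrite actM // ?act_cst ?mulr0 ?addr0 //; exact: smooth_cst.
Qed.

Lemma actN a f x : smooth f -> act rho a (fun y => - f y) x = - act rho a f x.
Proof.
move=> fs; rewrite -mulN1r -actZ //; congr act.
by apply/funext => y; rewrite mulN1r.
Qed.

Lemma actB a f g x : smooth f -> smooth g ->
  act rho a (fun y => f y - g y) x = act rho a f x - act rho a g x.
Proof. by move=> fs gs; rewrite actD // ?actN //; exact: smoothN. Qed.

Lemma smooth_act a f : smooth_section a -> smooth f -> smooth (act rho a f).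
Proof. exact: anchor_smooth (skew_anchor skewA) _ _. Qed.

(** If [h] vanishes near [x], then [chi * h = 0] for a bump function [chi] at
    [x], and the Leibniz rule gives [a . h = 0] at [x]. *)
Lemma act_local a f g V x : open V -> V x -> smooth f -> smooth g ->
  (forall y, V y -> f y = g y) -> act rho a f x = act rho a g x.
Proof.
move=> oV Vx fs gs fg; apply/subr0_eq.
have [chi [chis [U [oU Ux U1]] [C [cC CV C0]]]] := bump oV Vx.
have hs := smoothB fs gs.
rewrite -actB //.
have := actM a x chis hs; rewrite fg // subrr mul0r addr0 (U1 x Ux) mul1r => <-.
rewrite -(act_cst a 0 x); congr act; apply/funext => y.
have [Cy|Cy] := pselect (C y); last by rewrite C0 // mul0r.
by rewrite fg ?subrr ?mulr0 //; exact: CV.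
Qed.

Lemma smooth_br a b : smooth_section a -> smooth_section b -> smooth_section (br a b).
Proof. exact: skew_closed skewA _ _. Qed.

Lemma brC a b x : smooth_section a -> smooth_section b -> br a b x = - br b a x.
Proof. by move=> as_ bs; exact: skew_symmetric skewA _ _ as_ bs x. Qed.

Lemma brDr a b c x : smooth_section a -> smooth_section b -> smooth_section c ->
  br a (fun y => b y + c y) x = br a b x + br a c x.
Proof.
move=> as_ bs cs; have := skew_linearr skewA 1 as_ bs cs x.
rewrite scale1r => <-; congr (br a _ x).
by apply/functional_extensionality_dep => y; rewrite scale1r.
Qed.

Lemma brZr a b f x : smooth f -> smooth_section a -> smooth_section b ->
  br a (fun y => f y *: b y) x = f x *: br a b x + act rho a f x *: b x.
Proof. by move=> fs as_ bs; exact: skew_leibniz skewA _ _ _ fs as_ bs x. Qed.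

Lemma brDl a b c x : smooth_section a -> smooth_section b -> smooth_section c ->
  br (fun y => b y + c y) a x = br b a x + br c a x.
Proof.
move=> as_ bs cs; rewrite brC // ?brDr // ?[br _ a x]brC // ?opprD //.
exact: smooth_sectionD.
Qed.

Lemma brZl a b f x : smooth f -> smooth_section a -> smooth_section b ->
  br (fun y => f y *: b y) a x = f x *: br b a x - act rho a f x *: b x.
Proof.
move=> fs as_ bs; rewrite brC // ?brZr // ?[br b a x]brC // ?opprD ?scalerN //.
exact: smooth_sectionZ.
Qed.

(** The same argument as for [act_local]: the Leibniz rule applied to a
    difference multiplied by a bump function. *)
Lemma br_local a b c V x : open V -> V x ->
  smooth_section a -> smooth_section b -> smooth_section c ->
  (forall y, V y -> b y = c y) -> br a b x = br a c x.
Proof.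
move=> oV Vx as_ bs cs bc; apply/subr0_eq.
have [chi [chis [U [oU Ux U1]] [C [cC CV C0]]]] := bump oV Vx.
have ncs : smooth_section (fun y => -1 *: c y).
  by apply: smooth_sectionZ => //; exact: smooth_cst.
have ds := smooth_sectionD bs ncs.
have -> : br a b x - br a c x = br a (fun y => b y + -1 *: c y) x.
  rewrite brDr // (brZr _ (smooth_cst (M := M) (-1))) //.
  by rewrite act_cst scale0r addr0 scaleN1r.
have := brZr x chis as_ ds.
rewrite (U1 x Ux) scale1r scaleN1r (bc x Vx) subrr scaler0 addr0 => <-.
have := brZr x (smooth_cst (M := M) 0) as_ as_.
rewrite act_cst !scale0r addr0 => <-; congr (br a _ x).
apply/functional_extensionality_dep => y; rewrite scale0r.
have [Cy|Cy] := pselect (C y); last by rewrite C0 // scale0r.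
by rewrite bc ?scaleN1r ?subrr ?scaler0 //; exact: CV.
Qed.

(** The expression on the right is tensorial in [b], so a covector with these
    values exists; [lie_form] selects it. *)
Lemma lie_formE a al b x :
  smooth_section a -> smooth_section al -> smooth_section b ->
  pair (lie_form rho br a al x) (b x) =
    act rho a (fun y => pair (al y) (b y)) x - pair (al x) (br a b x).
Proof.
move=> as_ als bs.
have [theta thetaE] : exists theta : dual A x, forall b, smooth_section b ->
    act rho a (fun y => pair (al y) (b y)) x - pair (al x) (br a b x) =
      pair theta (b x).
  apply: tensorial_covector => [s t ss ts|f s fs ss].
    rewrite brDr // pairDr -[_ + pair (al x) _]opprK.
    rewrite (_ : (fun y => _) = fun y => pair (al y) (s y) + pair (al y) (t y)).
      by rewrite actD; [ring|exact: smooth_pair|exact: smooth_pair].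
    by apply/funext => y; rewrite pairDr.
  rewrite brZr // pairDr !pairZr.
  rewrite (_ : (fun y => _) = fun y => f y * pair (al y) (s y)).
    by rewrite actM //; [ring|exact: smooth_pair].
  by apply/funext => y; rewrite pairZr.
rewrite /lie_form; case: xgetP => [th _ H|H]; first exact: H.
by exfalso; apply: (H theta) => c cs; exact/esym/thetaE.
Qed.

(** Smoothness of [f] is needed for the anchor to be linear on it, without which
    [linfun] would not represent this function. *)
Lemma d_rhoE f x (v : A x) : smooth f -> pair (d_rho rho f x) v = rho v f.
Proof.
move=> fs; have lin : linear (fun v : A x => rho v f : R^o).
  by move=> r u w; rewrite anchor_lin.
pose L : {linear A x -> R^o} := HB.pack (fun v : A x => rho v f : R^o)
  (GRing.isLinear.Build _ _ _ _ _ lin).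
exact: (lfunE L v).
Qed.

End SkewAlgebroidCalculus.

Section Bivectors.
Variables (R : realType) (M : manifold R) (A : vbundle M).
Variable P : multivector A.
Hypothesis P2 : mvfield 2 P.

Lemma bivDl x (u v w : dual A x) : P [:: u + v; w] = P [:: u; w] + P [:: v; w].
Proof. by have := mv_linear P2 [::] [:: w] 1 u v; rewrite scale1r mul1r. Qed.

Lemma bivDr x (u v w : dual A x) : P [:: w; u + v] = P [:: w; u] + P [:: w; v].
Proof. by have := mv_linear P2 [:: w] [::] 1 u v; rewrite scale1r mul1r. Qed.

Lemma bivxx x (u : dual A x) : P [:: u; u] = 0.
Proof. exact: (mv_alternating P2 [::] [::] [::] u). Qed.

Lemma bivC x (u v : dual A x) : P [:: u; v] = - P [:: v; u].
Proof.
have := bivxx (u + v); rewrite bivDl !bivDr !bivxx add0r addr0 => /eqP.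
by rewrite addr_eq0 => /eqP.
Qed.

Lemma biv0r x (u : dual A x) : P [:: u; 0] = 0.
Proof.
have := bivDr 0 0 u; rewrite addr0 => /eqP.
by rewrite -subr_eq subrr eq_sym => /eqP.
Qed.

Lemma bivZr x (c : R) (u v : dual A x) : P [:: u; c *: v] = c * P [:: u; v].
Proof. by have := mv_linear P2 [:: u] [::] c v 0; rewrite /= addr0 biv0r addr0. Qed.

Lemma bivZl x (c : R) (u v : dual A x) : P [:: c *: u; v] = c * P [:: u; v].
Proof. by rewrite [LHS]bivC bivZr -mulrN -bivC. Qed.

Lemma biv_sumr x (u : dual A x) (I : Type) (r : seq I) (F : I -> dual A x) :
  P [:: u; \sum_(i <- r) F i] = \sum_(i <- r) P [:: u; F i].
Proof.
elim: r => [|i r IH]; first by rewrite !big_nil biv0r.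
by rewrite !big_cons bivDr IH.
Qed.

Lemma biv_suml x (u : dual A x) (I : Type) (r : seq I) (F : I -> dual A x) :
  P [:: \sum_(i <- r) F i; u] = \sum_(i <- r) P [:: F i; u].
Proof.
by rewrite [LHS]bivC biv_sumr -sumrN; apply: eq_bigr => i _; rewrite -bivC.
Qed.

Lemma smooth_biv (al be : section_of (dual A)) :
  smooth_section al -> smooth_section be -> smooth (fun x => P [:: al x; be x]).
Proof.
move=> /smooth_sectionP als /smooth_sectionP bes; apply: smooth_on_local => x _.
have [i xi] := frame_cover A x; have oi := @frame_dom_open _ _ A i.
exists (frame_dom i); split=> //.
apply: (smooth_on_eq (f := fun y => \sum_k \sum_l
    coord (frame (v := dual A) i y) k (al y) *
    (coord (frame (v := dual A) i y) l (be y) *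
     P [:: tnth (frame (v := dual A) i y) k; tnth (frame (v := dual A) i y) l]))) => //.
  move=> y yi; have bi := frame_basis (v := dual A) yi.
  rewrite [in RHS](coord_basis bi (memvf (al y))) biv_suml; apply: eq_bigr => k _.
  rewrite [in RHS](coord_basis bi (memvf (be y))) biv_sumr; apply: eq_bigr => l _.
  by rewrite bivZl bivZr -!tnth_nth.
apply: smooth_on_sum => // k; apply: smooth_on_sum => // l.
apply: (smooth_onM oi (als i k)); apply: (smooth_onM oi (bes i l)).
exact: (mv_smooth P2 i [:: k; l]).
Qed.

(** In a frame, [al] contracted with [P] is the vector whose coordinates are the
    values of [P] on [al] and on the dual frame. *)
Lemma pair_sharp x (al be : dual A x) : pair be (sharp P al) = P [:: al; be].
Proof.
have [i xi] := frame_cover A x.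
rewrite /sharp; case: xgetP => [v _ Hv|H]; first exact: Hv.
exfalso.
apply: (H (\sum_k P [:: al; tnth (dual_frame i x) k] *: tnth (frame i x) k)) => be'.
rewrite [in RHS](dual_frameE be' xi) biv_sumr -/(pair _ _) pair_sumr.
by apply: eq_bigr => k _; rewrite pairZr bivZr mulrC.
Qed.

Lemma smooth_sharp (al : section_of (dual A)) : smooth_section al ->
  smooth_section (fun x => sharp P (al x)).
Proof.
move=> als; apply: smooth_section_pair => be bes.
rewrite (_ : (fun x => _) = fun x => P [:: al x; be x]); first exact: smooth_biv.
by apply/funext => x; rewrite pair_sharp.
Qed.

Lemma sharpD x (u v : dual A x) : sharp P (u + v) = sharp P u + sharp P v.
Proof. by apply: pair_injr => be; rewrite pairDr !pair_sharp bivDl. Qed.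

Lemma sharpZ x (c : R) (u : dual A x) : sharp P (c *: u) = c *: sharp P u.
Proof. by apply: pair_injr => be; rewrite pairZr !pair_sharp bivZl. Qed.

End Bivectors.

(** * Multivector fields and exterior products *)

Lemma size_unshuffles (T : eqType) (s : seq T) p :
  p \in unshuffles s -> (size p.1.2 + size p.2)%N = size s.
Proof.
elim: s p => [|u s IH] p /=; first by rewrite inE => /eqP ->.
rewrite mem_cat => /orP[] /mapP[q /IH <- ->] //=.
by rewrite addnS.
Qed.

Section MultivectorFields.
Variables (R : realType) (M : manifold R) (A : vbundle M).
Implicit Types (P Q : multivector A) (a b : section_of A).

(** Each term evaluates the factors on lists whose sizes add up to the size of
    the whole list. *)
Lemma wedge_degree k l P Q x (s : seq (dual A x)) :
  (forall t : seq (dual A x), size t <> k -> P x t = 0) ->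
  (forall t : seq (dual A x), size t <> l -> Q x t = 0) ->
  size s <> (k + l)%N -> wedge P Q s = 0.
Proof.
move=> Pk Ql sz; rewrite /wedge big_seq big1 // => p /size_unshuffles ps.
have [pk|/eqP pk] := eqVneq (size p.1.2) k; last by rewrite Pk // mulr0 mul0r.
rewrite Ql ?mulr0 // => pl; apply: sz.
by rewrite -ps pk pl.
Qed.

(** Only the splitting with an empty first part contributes. *)
Lemma wedge_funl (f : M -> R) Q x (s : seq (dual A x)) :
  wedge (mv_of_fun f) Q s = f x * Q x s.
Proof.
suff gen (F : seq (dual A x) -> R) : \sum_(p <- unshuffles s)
    (-1) ^+ p.1.1 * mv_of_fun f p.1.2 * F p.2 = f x * F s by exact: gen.
elim: s F => [|u s IH] F /=.
  by rewrite big_seq1 /= expr0 mul1r.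
rewrite big_cat /= !big_map /= big1 => [|p _]; last by rewrite mulr0 mul0r.
rewrite add0r -(IH (fun t => F (u :: t))); apply: eq_bigr => -[[m t] t'] _ /=.
by case: t => [|v t] /=; [rewrite addn0|rewrite !mulr0 !mul0r].
Qed.

Lemma mvfield_fun (f : M -> R) : smooth f -> mvfield 0 (mv_of_fun (A := A) f).
Proof.
move=> fs; split=> [x [|u s]|x [|? ?] *|x [|? ?] *|i [|j J]] //=.
- by rewrite mulr0 addr0.
- by rewrite mulr0 addr0.
- exact: smooth_smooth_on.
- exact: smooth_on_cst.
Qed.

Lemma smooth_on_pair_dual_frame a (i : frame_index A) j : smooth_section a ->
  smooth_on (frame_dom i) (fun x => pair (tnth (dual_frame i x) j) (a x)).
Proof.
move=> /smooth_sectionP/(_ i j); apply: smooth_on_eq; first exact: frame_dom_open.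
by move=> x xi; rewrite /pair tnth_mktuple lfunE.
Qed.

Lemma mvfield_section a : smooth_section a -> mvfield 1 (mv_of_section a).
Proof.
move=> as_; split=> [x [|u [|v s]]|x [|u' [|? ?]] [|? ?] c u v
  |x [|? [|? ?]] [|? ?] [|? ?] u|i [|j [|j' J]]] //=;
  rewrite ?mulr0 ?addr0 //; try exact: smooth_on_cst.
- by rewrite -!/(pair _ _) !pairlE.
- exact: smooth_on_pair_dual_frame.
Qed.

Lemma mvfield_comb k (c : R) P Q :
  mvfield k P -> mvfield k Q -> mvfield k (mv_comb c P Q).
Proof.
move=> Pk Qk; split.
- by move=> x s sk; rewrite /mv_comb !(mv_degree Pk, mv_degree Qk) // mulr0 addr0.
- by move=> x s t r u v; rewrite /mv_comb !(mv_linear Pk, mv_linear Qk); ring.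
- by move=> x s t w u; rewrite /mv_comb !(mv_alternating Pk, mv_alternating Qk) mulr0 addr0.
- move=> i J; have oi := @frame_dom_open _ _ A i.
  apply: smooth_onD => //; last exact: mv_smooth Qk i J.
  apply: smooth_onM => //; first exact: smooth_on_cst.
  exact: mv_smooth Pk i J.
Qed.

Lemma wedge_sections a b x (u v : dual A x) :
  wedge (mv_of_section a) (mv_of_section b) [:: u; v] =
    pair u (a x) * pair v (b x) - pair v (a x) * pair u (b x).
Proof.
rewrite /wedge /= !big_cons big_nil /= -!/(pair _ _).
by rewrite !(mulr0, mul0r, add0r, addr0, expr0, mul1r, expr1, mulN1r) mulNr.
Qed.

Lemma wedge_sections_degree a b x (s : seq (dual A x)) : size s <> 2%N ->
  wedge (mv_of_section a) (mv_of_section b) s = 0.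
Proof.
by apply: (wedge_degree (k := 1) (l := 1)) => -[|? [|? ?]].
Qed.

Lemma mvfield_wedge_sections a b : smooth_section a -> smooth_section b ->
  mvfield 2 (wedge (mv_of_section a) (mv_of_section b)).
Proof.
move=> as_ bs; split.
- by move=> x s; exact: wedge_sections_degree.
- move=> x s t c u v.
  have [|ne] := eqVneq (size s + size t)%N 1%N.
    case: s => [|u' [|? ?]]; case: t => [|v' [|? ?]] // _;
    by rewrite /= !wedge_sections !pairlE; ring.
  rewrite !wedge_sections_degree ?mulr0 ?addr0 // !size_cat /= addnS => -[/eqP];
  by rewrite (negbTE ne).
- move=> x s t w u; have [|ne] := eqVneq (size s + size t + size w)%N 0%N.
    case: s t w => [|? ?] [|? ?] [|? ?] // _.
    by rewrite wedge_sections; ring.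
  rewrite wedge_sections_degree // !size_cat /= !size_cat /= !addnS => -[/eqP].
  by rewrite addnA (negbTE ne).
- move=> i J; have oi := @frame_dom_open _ _ A i.
  have [|ne] := eqVneq (size J) 2%N; last first.
    apply: (smooth_on_eq (f := fun=> 0)) => //; last exact: smooth_on_cst.
    by move=> x xi; rewrite wedge_sections_degree // size_map => /eqP; rewrite (negbTE ne).
  case: J => [|j [|k []]] // _.
  pose c (s : section_of A) l x := pair (tnth (@dual_frame _ _ A i x) l) (s x).
  apply: (smooth_on_eq (f := fun x => c a j x * c b k x + -1 * (c a k x * c b j x))) => //.
    by move=> x xi; rewrite wedge_sections /c mulN1r.
  have cs s l : smooth_section s -> smooth_on (frame_dom i) (c s l).
    exact: smooth_on_pair_dual_frame.
  apply: smooth_onD => //; first by apply: smooth_onM => //; exact: cs.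
  apply: smooth_onM => //; first exact: smooth_on_cst.
  by apply: smooth_onM => //; exact: cs.
Qed.

Lemma wedge_sectionr b Q x (u v w : dual A x) : mvfield 2 Q ->
  wedge Q (mv_of_section b) [:: u; v; w] =
  pair u (b x) * Q x [:: v; w] + pair v (b x) * Q x [:: w; u] +
  pair w (b x) * Q x [:: u; v].
Proof.
move=> Q2; rewrite (bivC Q2 w u) /wedge /= !big_cons big_nil /= -!/(pair _ _).
rewrite !(mulr0, mul0r, add0r, addr0, expr0, mul1r, expr1, expr2, mulN1r) /=; ring.
Qed.

End MultivectorFields.

(** * The Schouten bracket of two bivector fields *)

Section SchoutenBivectors.
Variables (R : realType) (M : manifold R) (A : vbundle M).
Variables (rho : anchor A) (br : bracket A).
Variable SN : multivector A -> multivector A -> multivector A.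
Hypothesis skewA : skew_algebroid rho br.
Hypothesis snA : schouten_bracket rho br SN.
Implicit Types (P Q : multivector A) (a b : section_of A).
Implicit Types (al be ga : section_of (dual A)).

(** If [Q] vanishes near [x], then [Q = (1 - chi) Q] for a bump function [chi]
    at [x]; both terms of the Leibniz rule vanish at [x], since [Q] and
    [1 - chi] do. *)
Lemma sn_local0 k l P Q (V : set M) x s : mvfield k P -> mvfield l Q ->
  open V -> V x -> (forall y, V y -> forall t, Q y t = 0) -> @SN P Q x s = 0.
Proof.
move=> Pk Ql oV Vx Q0.
have [chi [chis [U [oU Ux U1]] [C [cC CV C0]]]] := bump oV Vx.
have gs : smooth (fun y => 1 - chi y) by apply: smoothB => //; exact: smooth_cst.
have QE : Q = wedge (mv_of_fun (fun y => 1 - chi y)) Q.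
  apply/functional_extensionality_dep => y; apply/funext => t.
  rewrite wedge_funl; have [Cy|Cy] := pselect (C y).
    by rewrite Q0 ?mulr0 //; exact: CV.
  by rewrite C0 // subr0 mul1r.
rewrite {1}QE (sn_leibniz snA Pk (mvfield_fun A gs) Ql).
rewrite wedge_funl U1 // subrr mul0r mulr0 addr0 /wedge big1 // => p _.
by rewrite Q0 // mulr0.
Qed.

Lemma sn_local k l P Q Q' (V : set M) x s :
  mvfield k P -> mvfield l Q -> mvfield l Q' -> open V -> V x ->
  (forall y, V y -> forall t, Q y t = Q' y t) -> @SN P Q x s = @SN P Q' x s.
Proof.
move=> Pk Ql Ql' oV Vx QQ'; apply/subr0_eq; rewrite addrC -mulN1r.
rewrite -(sn_linearr snA (-1) Pk Ql' Ql).
apply: (sn_local0 _ Pk (mvfield_comb (-1) Ql' Ql) oV Vx) => y Vy t.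
by rewrite /mv_comb QQ' // mulN1r addNr.
Qed.

(** The definition of the Lie derivative of [P] evaluated on two covectors, with
    [P(al, L_a be)] rewritten as [L_a be] evaluated on [sharp P al]. *)
Lemma lie_bivector a P al be x :
  smooth_section a -> mvfield 2 P -> smooth_section al -> smooth_section be ->
  @SN (mv_of_section a) P x [:: al x; be x] =
    pair (be x) (br a (fun y => sharp P (al y)) x) -
    pair (al x) (br a (fun y => sharp P (be y)) x) -
    act rho a (fun y => P y [:: al y; be y]) x.
Proof.
move=> as_ P2 als bes.
pose fam j := if j is 0%N then al else be.
have fams j : smooth_section (fam j) by case: j.
have := sn_lie snA as_ P2 fams x.
rewrite /mkseq /= big_ord_recl big_ord1 /= => ->.
have PC y (u v : dual A y) : P y [:: u; v] = - P y [:: v; u] by exact: bivC.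
rewrite (PC x (lie_form rho br a al x)) -!(pair_sharp P2).
rewrite (lie_formE skewA x as_ als (smooth_sharp P2 bes)).
rewrite (lie_formE skewA x as_ bes (smooth_sharp P2 als)).
rewrite (_ : (fun y => pair (al y) _) = fun y => - P y [:: al y; be y]); last first.
  by apply/funext => y; rewrite (pair_sharp P2) PC.
rewrite (_ : (fun y => pair (be y) _) = fun y => P y [:: al y; be y]); last first.
  by apply/funext => y; rewrite (pair_sharp P2).
rewrite (actN skewA); last exact: smooth_biv.
ring.
Qed.

(** One third of the cyclic sum that gives the Schouten bracket of [P] and [Q].
    It is linear over the reals in [Q], in contrast with the quadratic formula
    for [[P, P]], and can therefore be checked on decomposable [Q]. *)
Definition schouten_term P Q al be ga x : R :=
  act rho (fun y => sharp Q (ga y)) (fun y => P y [:: al y; be y]) x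
  - pair (be x) (br (fun y => sharp Q (ga y)) (fun y => sharp P (al y)) x)
  + pair (al x) (br (fun y => sharp Q (ga y)) (fun y => sharp P (be y)) x)
  + act rho (fun y => sharp P (al y)) (fun y => Q y [:: be y; ga y]) x.

Definition schouten_cyclic P Q al be ga x : R :=
  schouten_term P Q al be ga x + schouten_term P Q be ga al x
  + schouten_term P Q ga al be x.

(** Here [sharp Q ga = ga(a) b - ga(b) a], and the rest is the Leibniz rule for
    the bracket and for the anchor.  The terms that differentiate a pairing
    cancel in the cyclic sum. *)
Lemma schouten_term_wedge P a b al be ga x : mvfield 2 P ->
  smooth_section a -> smooth_section b ->
  smooth_section al -> smooth_section be -> smooth_section ga ->
  let sal := fun y => sharp P (al y) in
  let sbe := fun y => sharp P (be y) in
  schouten_term P (wedge (mv_of_section a) (mv_of_section b)) al be ga x =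
    pair (ga x) (a x) * act rho b (fun y => P y [:: al y; be y]) x
    - pair (ga x) (b x) * act rho a (fun y => P y [:: al y; be y]) x
    - pair (ga x) (a x) * pair (be x) (br b sal x)
    + pair (ga x) (b x) * pair (be x) (br a sal x)
    + pair (ga x) (a x) * pair (al x) (br b sbe x)
    - pair (ga x) (b x) * pair (al x) (br a sbe x)
    - act rho sbe (fun y => pair (ga y) (a y)) x * pair (al x) (b x)
    + act rho sbe (fun y => pair (ga y) (b y)) x * pair (al x) (a x)
    + act rho sal (fun y => pair (be y) (a y)) x * pair (ga x) (b x)
    - act rho sal (fun y => pair (be y) (b y)) x * pair (ga x) (a x).
Proof.
move=> P2 as_ bs als bes gas sal sbe.
have W2 := mvfield_wedge_sections as_ bs; set W := wedge _ _ in W2 *.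
have sals : smooth_section sal by exact: smooth_sharp.
have sbes : smooth_section sbe by exact: smooth_sharp.
have WE : (fun y => sharp W (ga y)) =
    (fun y => pair (ga y) (a y) *: b y + (fun y => - pair (ga y) (b y) *: a y) y).
  apply/functional_extensionality_dep => y; apply: pair_injr => de.
  by rewrite (pair_sharp W2) /W wedge_sections !pairrE; ring.
have gab := smooth_pair gas as_; have gbb := smooth_pair gas bs.
have ngb := smoothN gbb.
have brW s : smooth_section s -> br (fun y => sharp W (ga y)) s x =
    pair (ga x) (a x) *: br b s x - act rho s (fun y => pair (ga y) (a y)) x *: b x
    + (- (pair (ga x) (b x) *: br a s x) + act rho s (fun y => pair (ga y) (b y)) x *: a x).
  move=> ss; rewrite WE (brDl skewA) //; try exact: smooth_sectionZ.
  by rewrite !(brZl skewA) // (actN skewA) // !scaleNr opprK.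
have actW f : smooth f -> act rho (fun y => sharp W (ga y)) f x =
    pair (ga x) (a x) * act rho b f x - pair (ga x) (b x) * act rho a f x.
  move=> fs; rewrite WE /act (anchorD skewA) ?(anchorZ skewA) //; ring.
rewrite /schouten_term -/sal -/sbe !brW // actW; last exact: smooth_biv.
rewrite (_ : (fun y => W y _) = fun y =>
    pair (be y) (a y) * pair (ga y) (b y) - pair (ga y) (a y) * pair (be y) (b y)).
  rewrite (actB skewA) ?(actM skewA) // ?pairrE; try by [exact: smooth_pair|
    apply: smoothM; exact: smooth_pair].
  ring.
by apply/funext => y; rewrite /W wedge_sections.
Qed.

End SchoutenBivectors.

Section SchoutenFormula.
Variables (R : realType) (M : manifold R) (A : vbundle M).
Variables (rho : anchor A) (br : bracket A).
Variable SN : multivector A -> multivector A -> multivector A.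
Hypothesis skewA : skew_algebroid rho br.
Hypothesis snA : schouten_bracket rho br SN.
Implicit Types (P Q : multivector A) (a b : section_of A).
Implicit Types (al be ga : section_of (dual A)).

(** The Leibniz rule gives [[P, a ^ b] = L_a P ^ b - a ^ L_b P], which
    [lie_bivector] makes explicit; the comparison with the cyclic sum is then
    formal. *)
Lemma schouten_wedge P a b al be ga x : mvfield 2 P ->
  smooth_section a -> smooth_section b ->
  smooth_section al -> smooth_section be -> smooth_section ga ->
  @SN P (wedge (mv_of_section a) (mv_of_section b)) x [:: al x; be x; ga x] =
  schouten_cyclic rho br P (wedge (mv_of_section a) (mv_of_section b)) al be ga x.
Proof.
move=> P2 as_ bs als bes gas.
have a1 := mvfield_section as_; have b1 := mvfield_section bs.
have SPE (c : section_of A) (cs : smooth_section c) :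
    SN P (mv_of_section c) = SN (mv_of_section c) P.
  apply/functional_extensionality_dep => y; apply/funext => s.
  by rewrite (sn_sym snA P2 (mvfield_section cs)) /= expr2 mulN1r opprK mul1r.
have aP2 : mvfield 2 (SN (mv_of_section a) P) := sn_degree snA a1 P2.
have bP2 : mvfield 2 (SN (mv_of_section b) P) := sn_degree snA b1 P2.
rewrite (sn_leibniz snA P2 a1 b1) !SPE // wedge_sectionr // wedge_normalisation //.
rewrite -!/(pair _ _) !(lie_bivector skewA snA) //.
rewrite /schouten_cyclic !(schouten_term_wedge skewA) //.
have -> : (-1) ^+ (3 * 1) = -1 :> R by rewrite exprS expr2; ring.
ring.
Qed.

Lemma schouten_term_comb (c : R) P Q Q' al be ga x :
  mvfield 2 P -> mvfield 2 Q -> mvfield 2 Q' ->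
  smooth_section al -> smooth_section be -> smooth_section ga ->
  schouten_term rho br P (mv_comb c Q Q') al be ga x =
  c * schouten_term rho br P Q al be ga x + schouten_term rho br P Q' al be ga x.
Proof.
move=> P2 Q2 Q2' als bes gas; have C2 := mvfield_comb c Q2 Q2'.
have sharpE : (fun y => sharp (mv_comb c Q Q') (ga y)) =
    (fun y => (fun z => c *: sharp Q (ga z)) y + sharp Q' (ga y)).
  apply/functional_extensionality_dep => y; apply: pair_injr => de.
  by rewrite (pair_sharp C2) !pairrE (pair_sharp Q2) (pair_sharp Q2').
have cs : smooth (fun _ : M => c) by exact: smooth_cst.
have sQ := smooth_sharp Q2 gas; have sQ' := smooth_sharp Q2' gas.
have actC f : smooth f -> act rho (fun y => sharp (mv_comb c Q Q') (ga y)) f x =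
    c * act rho (fun y => sharp Q (ga y)) f x + act rho (fun y => sharp Q' (ga y)) f x.
  by move=> fs; rewrite sharpE /act (anchor_lin skewA).
have brC s : smooth_section s -> br (fun y => sharp (mv_comb c Q Q') (ga y)) s x =
    c *: br (fun y => sharp Q (ga y)) s x + br (fun y => sharp Q' (ga y)) s x.
  move=> ss; rewrite sharpE (brDl skewA) //; last exact: smooth_sectionZ.
  by rewrite (brZl skewA) // (act_cst skewA) scale0r subr0.
rewrite /schouten_term actC; last exact: smooth_biv.
rewrite !brC; try exact: smooth_sharp.
rewrite (_ : act rho (fun y => sharp P (al y)) (fun y => mv_comb c Q Q' [:: be y; ga y]) x =
    c * act rho (fun y => sharp P (al y)) (fun y => Q y [:: be y; ga y]) x +
    act rho (fun y => sharp P (al y)) (fun y => Q' y [:: be y; ga y]) x).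
  by rewrite !pairrE; ring.
have QS := smooth_biv Q2 bes gas; have QS' := smooth_biv Q2' bes gas.
by rewrite (actD skewA) ?(actZ skewA) //; exact: smoothM.
Qed.

Lemma schouten_term_local P Q Q' (V : set M) al be ga x :
  mvfield 2 P -> mvfield 2 Q -> mvfield 2 Q' -> open V -> V x ->
  (forall y, V y -> forall s, Q y s = Q' y s) ->
  smooth_section al -> smooth_section be -> smooth_section ga ->
  schouten_term rho br P Q al be ga x = schouten_term rho br P Q' al be ga x.
Proof.
move=> P2 Q2 Q2' oV Vx QQ' als bes gas.
have shE y : V y -> sharp Q (ga y) = sharp Q' (ga y).
  by move=> Vy; apply: pair_injr => de; rewrite (pair_sharp Q2) (pair_sharp Q2') QQ'.
have sQ := smooth_sharp Q2 gas; have sQ' := smooth_sharp Q2' gas.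
have brE s : smooth_section s -> br (fun y => sharp Q (ga y)) s x =
    br (fun y => sharp Q' (ga y)) s x.
  move=> ss; rewrite (brC skewA) // [RHS](brC skewA) //; congr (- _).
  exact: (br_local skewA oV Vx).
rewrite /schouten_term !brE; try exact: smooth_sharp.
rewrite [in LHS]/act shE //; congr (_ - _ + _ + _).
by apply: (act_local skewA _ oV Vx); try exact: smooth_biv; move=> y Vy; exact: QQ'.
Qed.

(** In a frame [e_k] with dual frame [e^k], [2 Q] is the sum of the
    [e_k ^ sharp Q e^k].  With the frames cut off, this is an equality near [x]
    between [Q] and a finite sum of exterior products of global sections. *)
Lemma bivector_local_sum Q x : mvfield 2 Q -> exists (T : multivector A) V,
  [/\ open V, V x, forall y, V y -> forall s, Q y s = T y s &
   exists r : seq (section_of A * section_of A),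
    (forall p, List.In p r -> smooth_section p.1 /\ smooth_section p.2) /\
    T = foldr (fun p => mv_comb 1 (wedge (mv_of_section p.1) (mv_of_section p.2)))
         (wedge (mv_of_section (fun=> 0)) (mv_of_section (fun=> 0))) r].
Proof.
move=> Q2; have [i xi] := frame_cover A x.
have [e [V [oV Vx Vi es eE]]] := local_frame (E := A) xi.
have [e' [V' [oV' Vx' _ es' eE']]] := local_frame (E := dual A) xi.
pose F k : section_of A * section_of A :=
  (fun y => 2^-1 *: e k y, fun y => sharp Q (e' k y)).
pose r := [seq F k | k <- index_enum 'I_(rank A)].
exists (foldr (fun p => mv_comb 1 (wedge (mv_of_section p.1) (mv_of_section p.2)))
  (wedge (mv_of_section (fun=> 0)) (mv_of_section (fun=> 0))) r).
exists (V `&` V'); split; [exact: openI|by []| |exists r; split; last by []].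
- move=> y [Vy Vy'] s; have [|ne] := eqVneq (size s) 2%N; last first.
    rewrite (mv_degree Q2); last by apply/eqP.
    have ne' : size s <> 2%N by apply/eqP.
    rewrite /r; elim: (index_enum _) => [|k rr IH] /=.
      by rewrite wedge_sections_degree.
    by rewrite /mv_comb -IH wedge_sections_degree // mulr0 addr0.
  case: s => [|u [|v [|? ?]]] // _.
  have -> rr : foldr (fun p => mv_comb 1 (wedge (mv_of_section p.1) (mv_of_section p.2)))
      (wedge (mv_of_section (fun=> 0)) (mv_of_section (fun=> 0)))
      [seq F k | k <- rr] y [:: u; v] =
      \sum_(k <- rr) 2^-1 * (pair u (tnth (frame i y) k) * Q y [:: tnth (dual_frame i y) k; v]
        - pair v (tnth (frame i y) k) * Q y [:: tnth (dual_frame i y) k; u]).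
    elim: rr => [|k rr IH] /=.
      by rewrite wedge_sections !pair0r big_nil; ring.
    rewrite /mv_comb IH big_cons wedge_sections /F /= !pairrE !(pair_sharp Q2) eE // eE' //=.
    ring.
  rewrite -mulr_sumr sumrB.
  have QE (u' v' : dual A y) : \sum_k pair u' (tnth (frame i y) k) *
      Q y [:: tnth (dual_frame i y) k; v'] = Q y [:: u'; v'].
    rewrite [in RHS](dual_frameE u' (Vi _ Vy)) (biv_suml Q2); apply: eq_bigr => k _.
    by rewrite (bivZl Q2).
  by rewrite !QE [Q y [:: v; u]](bivC Q2); lra.
- rewrite /r; elim: (index_enum _) => [//|k rr IH] p /= [<-|/IH //]; split => /=.
    by apply: smooth_sectionZ; [exact: smooth_cst|exact: es].
  by apply: smooth_sharp => //; exact: es'.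
Qed.

(** Near [x], [Q] is a sum of exterior products of sections; both sides are
    local and additive in [Q]. *)
Theorem schouten_bivectors P Q al be ga x : mvfield 2 P -> mvfield 2 Q ->
  smooth_section al -> smooth_section be -> smooth_section ga ->
  @SN P Q x [:: al x; be x; ga x] = schouten_cyclic rho br P Q al be ga x.
Proof.
move=> P2 Q2 als bes gas.
have [T [V [oV Vx QT [r [rs TE]]]]] := bivector_local_sum x Q2.
have [T2 HT] : mvfield 2 T /\
    @SN P T x [:: al x; be x; ga x] = schouten_cyclic rho br P T al be ga x.
  rewrite {QT}TE; elim: r rs => [|p r IH] rs /=.
    have z := @smooth_section0 _ _ A; split; first exact: mvfield_wedge_sections.
    exact: schouten_wedge.
  have [ps1 ps2] := rs p (or_introl erefl).
  have [|T2 HT] := IH; first by move=> q qr; apply: rs; right.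
  have W2 := mvfield_wedge_sections ps1 ps2.
  split; first exact: mvfield_comb.
  rewrite (sn_linearr snA 1 P2 W2 T2) HT schouten_wedge // /schouten_cyclic.
  rewrite !(schouten_term_comb 1 _ P2 W2 T2) //; ring.
rewrite (sn_local snA _ P2 Q2 T2 oV Vx QT) HT /schouten_cyclic.
by rewrite !(schouten_term_local P2 Q2 T2 oV Vx QT).
Qed.

End SchoutenFormula.

(** * Jacobi structures *)

Section JacobiAlgebroid.
Variables (R : realType) (M : manifold R) (A : vbundle M).
Variables (rho : anchor A) (br : bracket A).
Variable SN : multivector A -> multivector A -> multivector A.
Variables (Pi : multivector A) (xi : section_of A) (lam : section_of (dual A)).
Hypothesis skewA : skew_algebroid rho br.
Hypothesis snA : schouten_bracket rho br SN.
Hypothesis jac : jacobi_structure SN Pi xi.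
Hypothesis lams : smooth_section lam.
Implicit Types (a b : section_of A).
Implicit Types (al be ga : section_of (dual A)).

Let Pi2 : mvfield 2 Pi := jacobi_bivector jac.
Let xis : smooth_section xi := jacobi_vector jac.
Let PiC x (u v : dual A x) : Pi [:: u; v] = - Pi [:: v; u] := bivC Pi2 u v.
Local Notation "# al" := (fun y => sharp Pi (al y)) (at level 5).
Local Notation brJ := (bracket_jacobi rho br Pi xi lam).

Lemma br_self a x : smooth_section a -> br a a x = 0.
Proof.
move=> as_; apply: pair_injr => de; rewrite pair0r.
have := congr1 (pair de) (brC skewA x as_ as_); rewrite pairNr; lra.
Qed.

(** This is the vanishing of the Lie derivative of [Pi] along [xi]. *)
Lemma jacobi_act al be x : smooth_section al -> smooth_section be ->
  act rho xi (fun y => Pi [:: al y; be y]) x =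
  pair (be x) (br xi #al x) - pair (al x) (br xi #be x).
Proof.
move=> als bes; have := lie_bivector skewA snA x xis Pi2 als bes.
by rewrite (jacobi_xiPi jac) => /esym/subr0_eq.
Qed.

(** With [P = Q = Pi] each bracket of sharps occurs twice in the cyclic sum, and
    so does each derivative of [Pi]; dividing [[Pi, Pi] = 2 xi ^ Pi] by 2 gives
    the relation, here solved for one of the three brackets. *)
Lemma jacobi_br al be ga x :
  smooth_section al -> smooth_section be -> smooth_section ga ->
  pair (ga x) (br #al #be x) =
    act rho #ga (fun y => Pi [:: al y; be y]) x
    + act rho #al (fun y => Pi [:: be y; ga y]) x
    + act rho #be (fun y => Pi [:: ga y; al y]) x
    - pair (al x) (br #be #ga x) - pair (be x) (br #ga #al x)
    - pair (al x) (xi x) * Pi [:: be x; ga x]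
    - pair (be x) (xi x) * Pi [:: ga x; al x]
    - pair (ga x) (xi x) * Pi [:: al x; be x].
Proof.
move=> als bes gas.
have := schouten_bivectors skewA snA x Pi2 Pi2 als bes gas.
rewrite (jacobi_PiPi jac) wedge_normalisation // /schouten_cyclic /schouten_term.
rewrite -!/(pair _ _).
have sh de : smooth_section de -> smooth_section #de by exact: smooth_sharp.
have brS de de' : smooth_section de -> smooth_section de' ->
  br #de #de' x = - br #de' #de x by move=> ds ds'; apply: (brC skewA); exact: sh.
rewrite (brS ga be) // (brS al ga) // (brS be al) // !pairNr; lra.
Qed.

(** Pairing with a section removes all Lie derivatives of forms; every property
    of the bracket is read off from this expression. *)
Lemma pair_bracket_jacobi al be b x :
  smooth_section al -> smooth_section be -> smooth_section b ->
  pair (brJ al be x) (b x) =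
    act rho #al (fun y => pair (be y) (b y)) x - pair (be x) (br #al b x)
    - act rho #be (fun y => pair (al y) (b y)) x + pair (al x) (br #be b x)
    - act rho b (fun y => Pi [:: al y; be y]) x
    + pair (al x) (xi x) * (act rho xi (fun y => pair (be y) (b y)) x
        - pair (be x) (br xi b x) - pair (be x) (b x))
    - pair (be x) (xi x) * (act rho xi (fun y => pair (al y) (b y)) x
        - pair (al x) (br xi b x) - pair (al x) (b x))
    - Pi [:: al x; be x] * pair (lam x) (b x).
Proof.
move=> als bes bs; rewrite /bracket_jacobi /koszul -!/(pair _ _) !pairlE.
have sal := smooth_sharp Pi2 als; have sbe := smooth_sharp Pi2 bes.
rewrite !(lie_formE skewA) // (d_rhoE skewA); last exact: smooth_biv.
rewrite /act; ring.
Qed.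

Lemma smooth_bracket_jacobi al be : smooth_section al -> smooth_section be ->
  smooth_section (brJ al be).
Proof.
move=> als bes; apply: smooth_dual_section => b bs.
have sal := smooth_sharp Pi2 als; have sbe := smooth_sharp Pi2 bes.
rewrite (funext (fun x => pair_bracket_jacobi x als bes bs)).
by do ?[apply: smoothB|apply: smoothD|apply: smoothM|apply: smooth_pair
  |apply: (smooth_act skewA)|apply: (smooth_br skewA)|apply: smooth_biv|by []].
Qed.

Lemma bracket_jacobiC al be x : smooth_section al -> smooth_section be ->
  brJ al be x = - brJ be al x.
Proof.
move=> als bes; apply: pair_injl => v; have [b bs <-] := section_through v.
rewrite pairNl !pair_bracket_jacobi //.
rewrite (_ : (fun y => Pi [:: be y; al y]) = fun y => - Pi [:: al y; be y]).
  rewrite (actN skewA); last exact: smooth_biv.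
  rewrite (PiC (be x)); ring.
by apply/funext => y; exact: PiC.
Qed.

Lemma bracket_jacobiD al be be' x :
  smooth_section al -> smooth_section be -> smooth_section be' ->
  brJ al (fun y => be y + be' y) x = brJ al be x + brJ al be' x.
Proof.
move=> als bes bes'; apply: pair_injl => v; have [b bs <-] := section_through v.
have bbs := smooth_sectionD bes bes'.
have sal := smooth_sharp Pi2 als; have sbe := smooth_sharp Pi2 bes.
have sbe' := smooth_sharp Pi2 bes'.
have pb := smooth_pair bes bs; have pb' := smooth_pair bes' bs.
have Pb := smooth_biv Pi2 als bes; have Pb' := smooth_biv Pi2 als bes'.
rewrite pairDl !pair_bracket_jacobi // !pairDl (bivDr Pi2).
rewrite (_ : (fun y => pair (be y + be' y) (b y)) =
  fun y => pair (be y) (b y) + pair (be' y) (b y)); last first.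
  by apply/funext => y; rewrite pairDl.
rewrite (_ : (fun y => Pi [:: al y; be y + be' y]) =
  fun y => Pi [:: al y; be y] + Pi [:: al y; be' y]); last first.
  by apply/funext => y; rewrite (bivDr Pi2).
rewrite (_ : #(fun y => be y + be' y) = fun y => #be y + #be' y); last first.
  by apply/functional_extensionality_dep => y; rewrite (sharpD Pi2).
rewrite !(actD skewA) // (brDl skewA) // pairDr.
rewrite {3}/act (anchorD skewA) /=; last exact: smooth_pair.
rewrite -/(act rho #be _ x) -/(act rho #be' _ x); ring.
Qed.

(** The derivatives of [f] along [b] that come from [Pi(al, f be)] and from the
    Lie derivative along [f (sharp be)] cancel, because [Pi] is alternating. *)
Lemma bracket_jacobi_leibniz (f : M -> R) al be x :
  smooth f -> smooth_section al -> smooth_section be ->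
  brJ al (fun y => f y *: be y) x =
    f x *: brJ al be x + act (anchor_jacobi rho Pi xi) al f x *: be x.
Proof.
move=> fs als bes; apply: pair_injl => v; have [b bs <-] := section_through v.
have fbs := smooth_sectionZ fs bes.
have sal := smooth_sharp Pi2 als; have sbe := smooth_sharp Pi2 bes.
have pb := smooth_pair bes bs; have Pb := smooth_biv Pi2 als bes.
have pa := smooth_pair als bs.
rewrite (pair_bracket_jacobi x als fbs bs) [RHS]pairDl [in RHS]pairZl [in RHS]pairZl.
rewrite (pair_bracket_jacobi x als bes bs) /= !pairZl (bivZr Pi2).
rewrite (_ : (fun y => pair (f y *: be y) (b y)) =
  fun y => f y * pair (be y) (b y)); last first.
  by apply/funext => y; rewrite pairZl.
rewrite (_ : (fun y => Pi [:: al y; f y *: be y]) =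
  fun y => f y * Pi [:: al y; be y]); last first.
  by apply/funext => y; rewrite (bivZr Pi2).
rewrite (_ : #(fun y => f y *: be y) = fun y => f y *: #be y); last first.
  by apply/functional_extensionality_dep => y; rewrite (sharpZ Pi2).
rewrite !(actM skewA) // (brZl skewA) // pairBr !pairZr (pair_sharp Pi2) (PiC (be x)).
rewrite [act rho (fun y => f y *: _) _ x]/act (anchorZ skewA) //.
rewrite [act (anchor_jacobi _ _ _) _ _ _]/act /anchor_jacobi /sharp_jacobi.
rewrite (anchorD skewA) // (anchorZ skewA) // -/(pair _ _).
rewrite -/(act rho #be _ x) -/(act rho xi f x) -/(act rho #al f x); ring.
Qed.

Lemma smooth_sharp_jacobi al : smooth_section al ->
  smooth_section (fun y => sharp_jacobi Pi xi (al y)).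
Proof.
move=> als; apply: smooth_sectionD; first exact: smooth_sharp.
by apply: smooth_sectionZ => //; exact: smooth_pair.
Qed.

Lemma skew_algebroid_jacobi :
  skew_algebroid (anchor_jacobi rho Pi xi) brJ.
Proof.
have lr (c : R) al be be' : smooth_section al -> smooth_section be ->
    smooth_section be' -> forall x,
    brJ al (fun y => c *: be y + be' y) x = c *: brJ al be x + brJ al be' x.
  move=> als bes bes' x; have cs : smooth (fun _ : M => c) := smooth_cst c.
  rewrite (bracket_jacobiD x als (smooth_sectionZ cs bes) bes').
  rewrite (bracket_jacobi_leibniz x cs als bes).
  suff -> : act (anchor_jacobi rho Pi xi) al (fun=> c) x = 0 by rewrite scale0r addr0.
  exact: (act_cst skewA (fun y => sharp_jacobi Pi xi (al y))).
split => //.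
- split.
  + by move=> x v; exact: (anchor_tangent (skew_anchor skewA) (sharp_jacobi Pi xi v)).
  + move=> x c v w f fs; rewrite /anchor_jacobi -(anchor_lin skewA) //; congr rho.
    apply: pair_injr => de; rewrite /sharp_jacobi -!/(pair _ _) !pairrE !(pair_sharp Pi2).
    rewrite (bivDl Pi2) (bivZl Pi2) !pairlE; ring.
  + move=> al f als fs.
    exact: (smooth_act skewA (smooth_sharp_jacobi als) fs).
- exact: smooth_bracket_jacobi.
- by move=> al be als bes x; exact: bracket_jacobiC.
- move=> c al al' be als als' bes x.
  have cals : smooth_section (fun y => c *: al y + al' y).
    by apply: smooth_sectionD => //; apply: smooth_sectionZ => //; exact: smooth_cst.
  rewrite bracket_jacobiC // lr // (bracket_jacobiC x als bes).
  by rewrite (bracket_jacobiC x als' bes) opprD scalerN.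
- by move=> f al be fs als bes x; exact: bracket_jacobi_leibniz.
Qed.

(** The failure of the sharp map to preserve brackets.  After pairing with [ga],
    the left-hand side is the bracket of covectors evaluated at [- sharp ga] and
    at [xi]; on the right-hand side the bracket of the two sums is expanded by
    the Leibniz rule.  The two Jacobi conditions then identify both sides, up to
    the term in [Pi(al, be)]. *)
Lemma sharp_jacobi_bracket al be x : smooth_section al -> smooth_section be ->
  sharp_jacobi Pi xi (brJ al be x) =
    br (fun y => sharp_jacobi Pi xi (al y)) (fun y => sharp_jacobi Pi xi (be y)) x
    + Pi [:: al x; be x] *: (xi x - sharp_jacobi Pi xi (lam x)).
Proof.
move=> als bes; apply: pair_injr => de; have [ga gas <-] := section_through de.
have sal := smooth_sharp Pi2 als; have sbe := smooth_sharp Pi2 bes.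
have sga := smooth_sharp Pi2 gas.
have pa := smooth_pair als xis; have pb := smooth_pair bes xis.
have xa := smooth_sectionZ pa xis; have xb := smooth_sectionZ pb xis.
have PiE (u v : section_of (dual A)) : (fun y => pair (u y) (sharp Pi (v y))) =
    fun y => Pi [:: v y; u y] by apply/funext => y; rewrite (pair_sharp Pi2).
rewrite {1}/sharp_jacobi -!/(pair _ _) !pairrE (pair_sharp Pi2).
rewrite (PiC (brJ al be x)) -(pair_sharp Pi2).
rewrite (pair_bracket_jacobi x als bes sga) (pair_bracket_jacobi x als bes xis).
rewrite !PiE -!/(pair _ _).
rewrite !(pair_sharp Pi2).
have -> : br (fun y => sharp_jacobi Pi xi (al y)) (fun y => sharp_jacobi Pi xi (be y)) x =
  br #al #be x + (pair (be x) (xi x) *: br #al xi x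
     + act rho #al (fun y => pair (be y) (xi y)) x *: xi x)
  + (pair (al x) (xi x) *: br xi #be x
     - act rho #be (fun y => pair (al y) (xi y)) x *: xi x
     + (pair (al x) (xi x) * act rho xi (fun y => pair (be y) (xi y)) x
       - pair (be x) (xi x) * act rho xi (fun y => pair (al y) (xi y)) x) *: xi x).
  rewrite [LHS](brDl skewA x _ sal xa); last exact: smooth_sharp_jacobi.
  rewrite (brDr skewA x sal sbe xb) (brDr skewA x xa sbe xb).
  rewrite (brZr skewA x pb sal xis) (brZl skewA x pa sbe xis).
  rewrite (brZr skewA x pb xa xis) (brZl skewA x pa xis xis) br_self //.
  rewrite [act rho (fun y => pair (al y) (xi y) *: xi y) _ x]/act (anchorZ skewA) //.
  by apply: pair_injr => de'; rewrite !pairrE /act; ring.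
have brS a b : smooth_section a -> smooth_section b -> br a b x = - br b a x.
  by move=> as_ bs; exact: (brC skewA).
rewrite !pairrE (jacobi_br x als bes gas).
rewrite (brS #al xi) // (brS #be xi) // (brS #al #ga) // !pairNr.
have flip u v : smooth_section u -> smooth_section v -> forall a,
    act rho a (fun y => Pi [:: u y; v y]) x = - act rho a (fun y => Pi [:: v y; u y]) x.
  move=> us vs a; rewrite -(actN skewA); last exact: smooth_biv.
  by congr act; apply/funext => y; exact: PiC.
rewrite (flip ga be) // !jacobi_act // (PiC (ga x) (be x)) (PiC (lam x) (ga x)).
rewrite br_self // !pair0r; ring.
Qed.

End JacobiAlgebroid.

Theorem corollary3p2 (R : realType) (M : manifold R) (A : vbundle M)
    (rho : anchor A) (br : bracket A)
    (SN : multivector A -> multivector A -> multivector A)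
    (Pi : multivector A) (xi : section_of A) (lam : section_of (dual A)) :
  almost_lie_algebroid rho br ->
  schouten_bracket rho br SN ->
  jacobi_structure SN Pi xi ->
  smooth_section lam ->
  ((forall x, in_ker_anchor rho (xi x - sharp_jacobi Pi xi (lam x))) ->
    almost_lie_algebroid (anchor_jacobi rho Pi xi)
                         (bracket_jacobi rho br Pi xi lam)) /\
  (almost_lie_algebroid (anchor_jacobi rho Pi xi)
                        (bracket_jacobi rho br Pi xi lam) ->
    forall x, Pi x <> (fun=> 0) ->
      in_ker_anchor rho (xi x - sharp_jacobi Pi xi (lam x))).
Proof.
move=> [skewA compat] snA jac lams; have Pi2 := jacobi_bivector jac.
have key al be x f : smooth_section al -> smooth_section be -> smooth f ->
    act (anchor_jacobi rho Pi xi) (bracket_jacobi rho br Pi xi lam al be) f x =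
    act (anchor_jacobi rho Pi xi) al (act (anchor_jacobi rho Pi xi) be f) x
    - act (anchor_jacobi rho Pi xi) be (act (anchor_jacobi rho Pi xi) al f) x
    + Pi x [:: al x; be x] * rho x (xi x - sharp_jacobi Pi xi (lam x)) f.
  move=> als bes fs; rewrite {1}/act /anchor_jacobi.
  rewrite (sharp_jacobi_bracket lam skewA snA jac) // (anchorD skewA) // (anchorZ skewA) //.
  congr (_ + _).
  exact: (compat _ _ (smooth_sharp_jacobi jac als) (smooth_sharp_jacobi jac bes) f fs x).
split=> [ker|[_ compJ] x Pix f fs].
  split; first exact: (skew_algebroid_jacobi skewA jac lams).
  by move=> al be als bes f fs x; rewrite key // (ker x f fs) mulr0 addr0.
have [s Ps] : exists s, Pi x s <> 0.
  apply: contrapT => H; apply: Pix; apply/funext => s.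
  by apply: contrapT => Ps; apply: H; exists s.
have := contra_not (mv_degree Pi2 (x := x) (s := s)) Ps.
move=> /contrapT; case: s Ps => [|u [|v [|? ?]]] // Ps _.
have [al als alx] := section_through u; have [be bes bex] := section_through v.
have := compJ al be als bes f fs x; rewrite key // alx bex.
move=> /eqP; rewrite -subr_eq0 addrC addKr mulf_eq0 => /orP[/eqP //|/eqP //].
Qed.
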